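(* Let $\mathcal{H}_1=\{H_{1,1},\dots,H_{1,r}\}$ have the $(\mathcal{F},v,\eta)$-strong EH-property and $\mathcal{H}_2=\{H_{2,1},\dots,H_{2,s}\}$ have the $(\mathcal{G},v,\eta)$-strong EH-property, with the vertex sets of the tournaments of $\mathcal{H}_1$ disjoint from those of $\mathcal{H}_2$ and $\langle\mathcal{F},\mathcal{G}\rangle=0$. Then the family $\mathcal{H}_1^{\mathcal{F}}\oplus\mathcal{H}_2^{\mathcal{G}}$ satisfies the Erdős–Hajnal Conjecture, i.e. has the EH-property.
   Context: Tournaments are finite; subtournament = induced subtournament; transitive = no directed cycle; $tr(T)$ = maximum size of a transitive subtournament of $T$. $V_1$ is complete to $V_2$ if every vertex of $V_1$ has an edge to every vertex of $V_2$. For disjoint nonempty $X,Y$, $d(X,Y)=e_{X,Y}/(|X||Y|)$, $e_{X,Y}$ = number of edges $(x,y)$ with $x\in X,y\in Y$. For a $\{0,1\}$-vector $v$ of length $m$, $\zeta^v(i)=|\{j\le i:v(j)=1\}|$; $\eta$ is a vector of positive integers of length $\zeta^v(m)$; $k=|\{j:v(j)=0\}|+\sum_i\eta(i)$. For a tournament $T$, $c>0$, $0\le\lambda<1$, a $(v,\eta,c,\lambda)$-m-sequence in $T$ is a sequence $\chi=(S_1,\dots,S_m)$ of pairwise disjoint subsets of $V(T)$ such that: if $v(i)=1$, $S_i$ induces a transitive subtournament partitioned into $S_{i,1},\dots,S_{i,\eta(\zeta^v(i))}$ with $S_{i,a}$ complete to $S_{i,b}$ for $a<b$ and $|S_{i,a}|\ge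 c\,tr(T)$; if $v(i)=0$, $|S_i|\ge c|T|$; $d(S_i,S_j)\ge1-\lambda$ for $i<j$. Its long representation $l(\chi)=(T_1,\dots,T_k)$ replaces each $S_i$ with $v(i)=1$ by $S_{i,1},\dots,S_{i,\eta(\zeta^v(i))}$ in order; $V(\chi)=\bigcup S_i$. A $c'$-strong pair in $\chi$ is a pair $(A,B)$ of disjoint subsets of $V(\chi)$ with $|A|\ge c'|T|$, either $|B|\ge c'|T|$ or ($B$ transitive and $|B|\ge c'\,tr(T)$), and $d(A,B)=1$ or $d(B,A)=1$. For $\mathcal{H}=\{H_1,\dots,H_t\}$, $V(H_i)=\{h^i_1,\dots\}$, and $\mathcal{F}=\{f_1,\dots,f_t\}$ with $f_i:V(H_i)\to\{1,\dots,k\}$ injective, $\mathcal{H}$ has the $(\mathcal{F},v,\eta)$-strong EH-property if for every $c_1>0$ there exist $\lambda_0>0,c_2>0$ such that for every tournament $T$, $0\le\lambda\le\lambda_0$ and $(v,\eta,c_1,\lambda)$-m-sequence $\chi$ in $T$ with $l(\chi)=(T_1,\dots,T_k)$, either there are $i$ and $x_j\in T_{f_i(h^i_j)}$ with $x_j\mapsto h^i_j$ an isomorphism from the subtournament induced on $\{x_j\}$ onto $H_i$, or $\chi$ contains a $c_2$-strong pair. Products: an edge $(x,y)$ is backward under an ordering if $y$ precedes $x$. For tournaments $H_1,H_2$ with disjoint vertex sets and injective $f_1:V(H_1)\to\mathbb{N}$, $f_2:V(H_2)\to\mathbb{N}$ with $f_1(x)\ne f_2(y)$ for all $x,y$ ($\langle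 f_1,f_2\rangle=0$), let $\theta_i$ order $V(H_i)$ by increasing $f_i$ and $\theta$ order $V(H_1)\cup V(H_2)$ by increasing value of $f_1$ on $V(H_1)$ and $f_2$ on $V(H_2)$. $H_1^{f_1}\oplus H_2^{f_2}$ is the tournament on $V(H_1)\cup V(H_2)$ whose backward edges under $\theta$ are exactly those of $H_1$ under $\theta_1$ and those of $H_2$ under $\theta_2$. For $\mathcal{F}=\{f_1,\dots,f_r\}$, $\mathcal{G}=\{g_1,\dots,g_s\}$, $\langle\mathcal{F},\mathcal{G}\rangle=0$ means $\langle f,g\rangle=0$ for all $f\in\mathcal{F},g\in\mathcal{G}$, and $\mathcal{H}_1^{\mathcal{F}}\oplus\mathcal{H}_2^{\mathcal{G}}=\{H_{1,i}^{f_i}\oplus H_{2,j}^{g_j}\}$. A finite family $\mathcal{H}$ has the EH-property if there is $\epsilon>0$ such that every tournament $T$ containing no member of $\mathcal{H}$ as a subtournament contains a transitive subtournament on at least $|T|^{\epsilon}$ vertices. *)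

(* Defs.v *)
From HB Require Import structures.
From mathcomp Require Import all_boot all_order all_algebra.
From mathcomp Require Import boolp reals exp.

Set Implicit Arguments.
Unset Strict Implicit.
Unset Printing Implicit Defensive.

Import Order.TTheory GRing.Theory Num.Theory.
Local Open Scope ring_scope.

Record tournament := Tournament {
  vert :> finType;
  edge : rel vert;
  edge_irr : irreflexive edge;
  edge_tour : forall x y : vert, x != y -> edge x y = ~~ edge y x
}.

(* Subtournaments are induced, so a vertex set stands for the subtournament *)
(* it induces. *)
Definition transitive_set (T : tournament) (S : {set T}) : Prop :=
  forall c : seq T, c != [::] -> {subset c <= S} -> ~ ucycle (@edge T) c.

Definition tr (T : tournament) : nat :=
  \max_(S : {set T} | `[< transitive_set S >]) #|S|.

Definition complete_to (T : tournament) (X Y : {set T}) : Prop :=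
  forall x y, x \in X -> y \in Y -> edge x y.

Definition edges_between (T : tournament) (X Y : {set T}) : {set T * T} :=
  [set p in setX X Y | edge p.1 p.2].

(* Meant for nonempty X and Y; the value is 0 if X or Y is empty. *)
Definition density (R : realType) (T : tournament) (X Y : {set T}) : R :=
  #|edges_between X Y|%:R / (#|X|%:R * #|Y|%:R).

Definition embedding (H T : tournament) (phi : H -> T) : Prop :=
  injective phi /\ forall x y : H, edge (phi x) (phi y) = edge x y.

Definition contains (T H : tournament) : Prop :=
  exists phi : H -> T, embedding phi.

(* zeta v i = number of ones among the first i entries of v, so the entry of *)
(* v with 0-based index i has zeta value zeta v i.+1. *)
Definition zeta (m : nat) (v : m.-tuple bool) (i : nat) : nat :=
  count id (take i v).

Definition long_size (m : nat) (v : m.-tuple bool)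
    (eta : (zeta v m).-tuple nat) : nat :=
  (count negb v + sumn eta)%N.

(* mparts chi i is the list S_{i,1}, S_{i,2}, ... and is relevant only for the *)
(* indices i with v(i) = 1. *)
Record mseq (T : tournament) (m : nat) := MSeq {
  msets : 'I_m -> {set T};
  mparts : 'I_m -> seq {set T}
}.

Record is_mseq (R : realType) (T : tournament) (m : nat) (v : m.-tuple bool)
    (eta : (zeta v m).-tuple nat) (c lambda : R) (chi : mseq T m) : Prop :=
  IsMSeq {
    mseq_c_gt0 : 0 < c;
    mseq_lambda : 0 <= lambda < 1;
    mseq_disjoint : forall i j : 'I_m, i != j ->
      [disjoint msets chi i & msets chi j];
    mseq_transitive : forall i : 'I_m, tnth v i ->
      transitive_set (msets chi i);
    mseq_parts_size : forall i : 'I_m, tnth v i ->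
      size (mparts chi i) = nth 0%N eta (zeta v i.+1).-1;
    mseq_parts_cover : forall i : 'I_m, tnth v i ->
      msets chi i = \bigcup_(X <- mparts chi i) X;
    mseq_parts_disjoint : forall (i : 'I_m) (a b : nat), tnth v i ->
      (a < b < size (mparts chi i))%N ->
      [disjoint nth set0 (mparts chi i) a & nth set0 (mparts chi i) b];
    mseq_parts_complete : forall (i : 'I_m) (a b : nat), tnth v i ->
      (a < b < size (mparts chi i))%N ->
      complete_to (nth set0 (mparts chi i) a) (nth set0 (mparts chi i) b);
    mseq_parts_large : forall (i : 'I_m) (X : {set T}), tnth v i ->
      X \in mparts chi i -> c * (tr T)%:R <= #|X|%:R;
    mseq_linear : forall i : 'I_m, ~~ tnth v i ->
      c * #|T|%:R <= #|msets chi i|%:R;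
    mseq_dense : forall i j : 'I_m, (i < j)%N ->
      1 - lambda <= density R (msets chi i) (msets chi j)
  }.

Definition long_rep (T : tournament) (m : nat) (v : m.-tuple bool)
    (chi : mseq T m) : seq {set T} :=
  flatten [seq if tnth v i then mparts chi i else [:: msets chi i]
          | i <- enum 'I_m].

Definition mseq_support (T : tournament) (m : nat) (chi : mseq T m) : {set T} :=
  \bigcup_(i < m) msets chi i.

Definition strong_pair (R : realType) (T : tournament) (m : nat)
    (chi : mseq T m) (c : R) (A B : {set T}) : Prop :=
  [/\ A \subset mseq_support chi /\ B \subset mseq_support chi,
      [disjoint A & B],
      c * #|T|%:R <= #|A|%:R,
      c * #|T|%:R <= #|B|%:R \/
        (transitive_set B /\ c * (tr T)%:R <= #|B|%:R) &
      density R A B = 1 \/ density R B A = 1].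

(* The labels F i take values in {1, ..., long_size eta}, hence the .-1 in the *)
(* indexing of the long representation. The host tournament is nonempty: for *)
(* #|T| = 0 the size conditions hold for empty sets, whose densities are *)
(* undefined. *)
Definition strong_EH (R : realType) (I : finType) (H : I -> tournament)
    (F : forall i, H i -> nat) (m : nat) (v : m.-tuple bool)
    (eta : (zeta v m).-tuple nat) : Prop :=
  forall c1 : R, 0 < c1 ->
  exists lambda0 c2 : R, [/\ 0 < lambda0, 0 < c2 &
    forall (T : tournament) (lambda : R) (chi : mseq T m),
      (0 < #|T|)%N -> 0 <= lambda <= lambda0 -> is_mseq eta c1 lambda chi ->
      (exists (i : I) (phi : H i -> T),
         embedding phi /\
         forall h, phi h \in nth set0 (long_rep v chi) (F i h).-1) \/
      (exists A B : {set T}, strong_pair chi c2 A B)].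

Definition orthogonal_labels (V1 V2 : Type) (f1 : V1 -> nat) (f2 : V2 -> nat) :
    Prop :=
  forall x y, f1 x <> f2 y.

Definition backward (H : tournament) (f : H -> nat) (x y : H) : bool :=
  edge x y && (f y < f x)%N.

Section Product.
Variables (H1 H2 : tournament) (f1 : H1 -> nat) (f2 : H2 -> nat).

Definition prod_label (u : H1 + H2) : nat :=
  match u with inl x => f1 x | inr y => f2 y end.

Definition prod_backward (u w : H1 + H2) : bool :=
  match u, w with
  | inl x, inl y => backward f1 x y
  | inr x, inr y => backward f2 x y
  | _, _ => false
  end.

Definition prod_edge (u w : H1 + H2) : bool :=
  if (prod_label u < prod_label w)%N then ~~ prod_backward w u
  else prod_backward u w.

Hypotheses (inj1 : injective f1) (inj2 : injective f2).
Hypothesis (orth : orthogonal_labels f1 f2).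

Lemma prod_label_inj : injective prod_label.
Proof.
move=> [x|x] [y|y] /=; first by move/inj1->.
- by move/orth.
- by move/esym/orth.
- by move/inj2->.
Qed.

Lemma prod_edge_irr : irreflexive prod_edge.
Proof.
by move=> [x|x]; rewrite /prod_edge /= ltnn /backward ltnn andbF.
Qed.

Lemma prod_edge_tour u w : u != w -> prod_edge u w = ~~ prod_edge w u.
Proof.
move=> neq; rewrite /prod_edge.
case: ltngtP => [_|_|/prod_label_inj eq_uw] //; first by rewrite negbK.
by rewrite eq_uw eqxx in neq.
Qed.

(* The vertex set is the disjoint union H1 + H2. *)
Definition tprod : tournament := Tournament prod_edge_irr prod_edge_tour.
End Product.

Definition EH_property (R : realType) (I : finType) (H : I -> tournament) :
    Prop :=
  exists2 eps : R, 0 < eps &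
    forall T : tournament, (forall i, ~ contains T (H i)) ->
    exists S : {set T}, transitive_set S /\ #|T|%:R `^ eps <= #|S|%:R.

(* Main.v *)
Require Import Defs.
From mathcomp Require Import all_boot all_order all_algebra.
From mathcomp Require Import boolp reals exp.
From mathcomp Require Import zify ring lra.

(* The constant c1 is fixed before lambda0 in the strong EH-property, so the     *)
(* m-sequences must have size constants that do not depend on the density: for  *)
(* a tournament omitting a fixed H, embedding H greedily produces, for every    *)
(* function Lam, a pair of sets of relative size 1/N and density 1 - 1/Lam(N)   *)
(* with N bounded in terms of H and Lam. Iterating inside the second set gives  *)
(* any number of such sets. In a minimal counterexample T to |T|^eps <= tr(T)   *)
(* with eps small, every linear-sized set contains a transitive set of size     *)
(* tr(T)/2 and there is no strong pair. Replacing some of the sets by           *)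
(* transitive subsets and discarding the vertices that are not well joined to   *)
(* the other sets gives an m-sequence in which every vertex is forward-adjacent *)
(* to almost all of every part in another block. The first strong property then *)
(* yields a copy of some H1_i; the parts restricted to the common forward       *)
(* neighbours of this copy still form an m-sequence, and the second property    *)
(* yields in it a copy of some H2_j, all of whose edges to the first copy are   *)
(* forward.                                                                     *)
(* The families are allowed to be empty, but then strong EH-properties fail: a  *)
(* blow-up built from a skew form over F_p has long m-sequences and, by         *)
(* Chebyshev's inequality, no strong pair.                                      *)

(** It suffices to exclude a minimal counterexample T to tr(T) >= |T|^eps ([EH_by_critical]). With
    eps tied to a small c by c^eps = 1 - c, every proper subset of relative size at least c contains
    a transitive set of size at least (1 - c)|T|^eps. Gluing such sets along a complete pair would
    beat the bound on tr(T), so strong pairs do not exist ([critical_no_strong_pair]), and on every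
    m-sequence with suitable constants the strong EH-properties must produce copies.

    The obstacle is the order of quantifiers: the size constant is fixed before the admissible
    density defect. [exists_dense_sequence] lets the defect be an arbitrary function of the relative
    size 1/N, with N bounded by an M that does not depend on T; c is chosen after M.
    [exists_regular_family] then makes the density hold vertex by vertex, so that a copy of a member
    of the first family spoils at most half of each part ([forward_part_large]), and the second
    property applies to what is left. In [contains_tprod] all edges between the two copies follow
    the labels: across blocks by the choice of the forward parts, inside a block by completeness
    between its parts.

    The argument needs one product tournament that T omits. [strong_EH_nonempty] supplies it, by a
    construction in which strong pairs are excluded by a second-moment count. *)

Set Implicit Arguments.
Unset Strict Implicit.
Unset Printing Implicit Defensive.

Import Order.TTheory GRing.Theory Num.Theory.

(** * Transitive sets *)

Section Chop.
Variable T : eqType.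
Implicit Types s : seq T.

Definition chop s k p := take k (drop (p * k) s).

Lemma size_chop s q k p : q * k <= size s -> p < q -> size (chop s k p) = k.
Proof.
move=> qk pq; rewrite size_takel // size_drop leq_subRL -?mulSnr.
  by apply: leq_trans qk; rewrite leq_mul2r pq orbT.
by apply: leq_trans qk; rewrite leq_mul2r ltnW ?orbT.
Qed.

Lemma mem_chop s k p x : x \in chop s k p ->
  exists i, [/\ p * k <= i, i < p.+1 * k, i < size s & forall x0, x = nth x0 s i].
Proof.
move=> xs; have := xs; rewrite -index_mem; set j := index _ _ => jlt.
have := jlt; rewrite size_take_min size_drop leq_min => /andP[jk js].
exists (p * k + j); split; [exact: leq_addr| |by rewrite -ltn_subRL|].
  by rewrite mulSnr ltn_add2l.
by move=> x0; rewrite -nth_drop -(nth_take x0 jk) nth_index.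
Qed.

Lemma chop_sub s k p : {subset chop s k p <= s}.
Proof. by move=> x /mem_take/mem_drop. Qed.

Lemma chop_index_lt k p p' i i' :
  p < p' -> i < p.+1 * k -> p' * k <= i' -> i < i'.
Proof.
move=> pp ik; apply: leq_trans; apply: leq_trans ik _.
by rewrite leq_mul2r pp orbT.
Qed.

Lemma chop_neq s k p p' x y : uniq s -> p < p' ->
  x \in chop s k p -> y \in chop s k p' -> x != y.
Proof.
move=> us pp /mem_chop[i [_ ip si ex]] /mem_chop[j [jp _ sj ey]].
by rewrite (ex x) (ey x) nth_uniq // ltn_eqF //; apply: chop_index_lt pp ip jp.
Qed.
End Chop.

Lemma leq_divn_double n q : 0 < q -> q <= n -> n <= 2 * q * (n %/ q).
Proof.
move=> q0 qn; rewrite {1}(divn_eq n q) mulnAC -mulnA mul2n -addnn mulnC.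
rewrite leq_add2l.
apply: leq_trans (ltnW (ltn_pmod n q0)) _.
by rewrite leq_pmulr // divn_gt0.
Qed.

Lemma card_bigcup_leq (T : finType) (I : Type) (s : seq I) (P : pred I)
    (F : I -> {set T}) :
  #|\bigcup_(i <- s | P i) F i| <= \sum_(i <- s | P i) #|F i|.
Proof.
elim/big_ind2: _ => [|a X b Y aX bY|//]; first by rewrite cards0.
by apply: leq_trans (leq_card_setU _ _) _; apply: leq_add.
Qed.

Section Tournaments.
Variable T : tournament.
Implicit Types (x y z : T) (X Y S A B : {set T}).

Lemma edge_asym x y : edge x y -> edge y x = false.
Proof.
move=> exy; have xy : x != y.
  by apply: contraTneq exy => ->; rewrite edge_irr.
by move: exy; rewrite edge_tour // => /negbTE.
Qed.

Lemma edge_neq x y : edge x y -> x != y.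
Proof. by apply: contraTneq => ->; rewrite edge_irr. Qed.

(** A failure of transitivity is a directed triangle; conversely, transitivity along a directed
    cycle gives a loop. *)
Lemma transitive_setP S : transitive_set S <->
  {in S & &, transitive (@edge T)}.
Proof.
split=> [trS y x z yS xS zS exy eyz | trS].
  have [-> //|xz] := eqVneq (edge x z) true.
  have nxz : x != z.
    by apply: contraTneq eyz => <-; rewrite (edge_asym exy).
  have ezx : edge z x by rewrite edge_tour 1?eq_sym //; case: edge xz.
  case: (trS [:: x; y; z]) => //; first by move=> w; rewrite !inE => /or3P[]/eqP->.
  rewrite /ucycle /= exy eyz ezx /= !inE negb_or nxz edge_neq //=.
  by rewrite edge_neq.
case=> // x p _ sub /andP[/= cyc _].
have xS : x \in S by apply: sub; rewrite mem_head.
have allS : all (mem S) (x :: rcons p x).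
  by apply/allP => y; rewrite -rcons_cons mem_rcons inE => /predU1P[->|/sub].
have /allP/(_ x) := order_path_min_in trS allS cyc.
by rewrite mem_rcons mem_head edge_irr => /(_ isT).
Qed.

Lemma transitive_set_sub S X : X \subset S -> transitive_set S ->
  transitive_set X.
Proof.
move/subsetP => sub trS c c0 cX; apply: trS => // x /cX; exact: sub.
Qed.

Lemma transitive_set0 : transitive_set (set0 : {set T}).
Proof. by apply/transitive_setP => y x z; rewrite inE. Qed.

Lemma transitive_set1 x : transitive_set [set x].
Proof.
by apply/transitive_setP => y z w /set1P-> /set1P-> /set1P->.
Qed.

Lemma transitive_setU A B : complete_to A B -> transitive_set A ->
  transitive_set B -> transitive_set (A :|: B).
Proof.
move=> AB /transitive_setP trA /transitive_setP trB; apply/transitive_setP.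
move=> y x z /setUP[]yS /setUP[]xS /setUP[]zS exy eyz.
- exact: trA exy eyz.
- exact: AB.
- by have := AB _ _ yS xS; rewrite (edge_asym exy).
- by have := AB _ _ yS xS; rewrite (edge_asym exy).
- by have := AB _ _ zS yS; rewrite (edge_asym eyz).
- exact: AB.
- by have := AB _ _ zS yS; rewrite (edge_asym eyz).
- exact: trB exy eyz.
Qed.

Lemma leq_tr S : transitive_set S -> #|S| <= tr T.
Proof. by move=> trS; apply: leq_bigmax_cond; apply/asboolP. Qed.

Lemma tr_witness : exists2 S : {set T}, transitive_set S & #|S| = tr T.
Proof.
have [|S /asboolP trS eS] := @eq_bigmax_cond _
  [pred S : {set T} | `[< transitive_set S >]] (fun S => #|S|).
  by apply/card_gt0P; exists set0; rewrite inE; apply/asboolP/transitive_set0.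
by exists S; rewrite // -eS.
Qed.

Lemma leq_tr_card : tr T <= #|T|.
Proof. by have [S _ <-] := tr_witness; apply: max_card. Qed.

Lemma tr_gt0 : 0 < #|T| -> 0 < tr T.
Proof.
move=> /card_gt0P[x _]; rewrite -(cards1 x); exact/leq_tr/transitive_set1.
Qed.

Definition out x := [set y | edge x y].
Definition inn x := [set y | edge y x].

(** Keep a vertex and recurse into the larger of its out- and in-neighbourhoods. *)
Lemma exists_transitive_log k X : 2 ^ k <= #|X| ->
  exists2 S : {set T}, S \subset X & transitive_set S /\ k < #|S|.
Proof.
elim: k X => [|k IH] X leX.
  have /card_gt0P[x xX] := leX; exists [set x]; first by rewrite sub1set.
  by split; [exact: transitive_set1|rewrite cards1].
have /card_gt0P[x xX] : 0 < #|X| by apply: leq_trans leX; rewrite expn_gt0.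
have Xx : #|X| <= (#|X :&: out x| + #|X :&: inn x|).+1.
  rewrite (cardsD1 x) xX ltnS -cardsUI; apply: leq_trans (leq_addr _ _).
  apply/subset_leq_card/subsetP => y; rewrite !inE => /andP[yx ->] /=.
  by rewrite (edge_tour yx) orbN.
have {leX} : (2 ^ k <= #|X :&: out x|) || (2 ^ k <= #|X :&: inn x|).
  rewrite -[_ || _]negbK negb_or -!ltnNge; apply/negP => /andP[h1 h2].
  have := leq_trans leX Xx; rewrite leqNgt => /negP[].
  by rewrite expnS mul2n -addnn -addSn -addnS leq_add.
case/orP=> /IH[S SX [trS kS]]; exists (x |: S).
- by rewrite subUset sub1set xX (subset_trans SX) ?subsetIl.
- split; last rewrite cardsU1; last first.
    suff -> : x \notin S by [].
    by apply/negP => /(subsetP SX); rewrite !inE edge_irr andbF.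
  apply: transitive_setU => //; last exact: transitive_set1.
  by move=> u w /set1P-> /(subsetP SX); rewrite !inE => /andP[].
- by rewrite subUset sub1set xX (subset_trans SX) ?subsetIl.
- split; last rewrite cardsU1; last first.
    suff -> : x \notin S by [].
    by apply/negP => /(subsetP SX); rewrite !inE edge_irr andbF.
  rewrite setUC; apply: transitive_setU => //; last exact: transitive_set1.
  by move=> w u /(subsetP SX) h /set1P->; move: h; rewrite !inE => /andP[].
Qed.

Lemma tr_log k : 2 ^ k <= #|T| -> k < tr T.
Proof.
rewrite -cardsT => /exists_transitive_log[S _ [trS]] kS.
exact: leq_trans kS (leq_tr trS).
Qed.

(** The reflexive closure of [edge] totally orders a transitive set, and consecutive segments of the
    sorted list are the required pieces. *)
Lemma chop_transitive S k q : transitive_set S -> q * k <= #|S| ->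
  exists P : nat -> {set T}, [/\ forall p, P p \subset S,
    forall p, p < q -> #|P p| = k &
    forall p p', p < p' -> complete_to (P p) (P p')].
Proof.
move=> /transitive_setP trS qk.
pose e x y := (x == y) || edge x y.
have etot : total e.
  by move=> x y; rewrite /e eq_sym; case: eqVneq => // /edge_tour->; rewrite orbN.
pose s := sort e (enum S).
have ss : s =i S by move=> x; rewrite mem_sort mem_enum.
have us : uniq s by rewrite sort_uniq enum_uniq.
have szs : size s = #|S| by rewrite size_sort -cardE.
have ps : pairwise e s.
  rewrite -(sorted_pairwise_in (P := mem S)); first exact: sort_sorted.
    move=> y x z yS xS zS /orP[/eqP->//|exy] /orP[/eqP<-|eyz].
      by rewrite /e exy orbT.
    by rewrite /e (trS _ _ _ yS xS zS) ?orbT.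
  by apply/allP => x; rewrite ss.
exists (fun p => [set x in chop s k p]); split=> [p|p pq|p p' pp x y].
- by apply/subsetP => x; rewrite inE => /chop_sub; rewrite ss.
- rewrite cardsE (card_uniqP _) ?take_uniq ?drop_uniq //.
  by rewrite (size_chop _ pq) // szs.
rewrite !inE => xp yp; have := chop_neq us pp xp yp.
have [i [_ ip si ex]] := mem_chop xp; have [j [jp _ sj ey]] := mem_chop yp.
have ij := chop_index_lt pp ip jp.
have /(pairwiseP x)/(_ i j) := ps.
by rewrite !inE si sj -ex -ey ij => /(_ isT isT isT)/orP[/eqP->|]; rewrite ?eqxx.
Qed.
End Tournaments.

Definition induced_edge (T : tournament) (X : {set T}) : rel {x | x \in X} :=
  fun u w => edge (val u) (val w).

Lemma induced_irr (T : tournament) (X : {set T}) : irreflexive (@induced_edge T X).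
Proof. by move=> u; rewrite /induced_edge edge_irr. Qed.

Lemma induced_tour (T : tournament) (X : {set T}) (u w : {x | x \in X}) :
  u != w -> induced_edge u w = ~~ induced_edge w u.
Proof. by move=> uw; rewrite /induced_edge edge_tour. Qed.

Definition induced (T : tournament) (X : {set T}) : tournament :=
  Tournament (@induced_irr T X) (@induced_tour T X).
Arguments induced : clear implicits.

Lemma card_induced (T : tournament) (X : {set T}) : #|induced T X| = #|X|.
Proof. exact: card_sig. Qed.

Lemma induced_contains (T H : tournament) (X : {set T}) :
  contains (induced T X) H -> contains T H.
Proof.
case=> phi [inj ed]; exists (fun h => val (phi h)); split; last exact: ed.
by move=> u w /val_inj/inj.
Qed.

Lemma induced_transitive (T : tournament) (X : {set T}) (S : {set induced T X}) :
  transitive_set S ->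
  exists2 S' : {set T}, S' \subset X & transitive_set S' /\ #|S'| = #|S|.
Proof.
move=> /transitive_setP trS; exists [set val u | u in S].
  by apply/subsetP => _ /imsetP[u _ ->]; apply: valP.
split; last by rewrite card_imset //; apply: val_inj.
apply/transitive_setP => _ _ _ /imsetP[u uS ->] /imsetP[w wS ->] /imsetP[z zS ->].
exact: trS.
Qed.

(** * Dense pairs in tournaments omitting a fixed tournament *)

Section Counting.
Variable T : finType.
Implicit Types (e : rel T) (x y : T) (X Y : {set T}).

Definition deg e x Y := #|[set y in Y | e x y]|.
Definition pairs e X Y := \sum_(x in X) deg e x Y.

Lemma deg_sub e x Y Y' : Y' \subset Y -> deg e x Y' <= deg e x Y.
Proof.
move=> /subsetP sub; apply/subset_leq_card/subsetP => y.
by rewrite !inE => /andP[/sub-> ->].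
Qed.

Lemma pairs_sub e X X' Y Y' : X' \subset X -> Y' \subset Y ->
  pairs e X' Y' <= pairs e X Y.
Proof.
move=> sX sY; rewrite [leqRHS](big_setID X') /= (setIidPr sX).
by apply: leq_trans (leq_addr _ _); apply: leq_sum => x _; apply: deg_sub.
Qed.

Lemma eq_pairs e e' X Y : {in X & Y, e =2 e'} -> pairs e X Y = pairs e' X Y.
Proof.
move=> ee; apply: eq_bigr => x xX; congr #|pred_of_set _|.
by apply/setP => y; rewrite !inE; case: (boolP (y \in Y)) => //= yY; apply: ee.
Qed.

Lemma pairsC e X Y : pairs e X Y = pairs (fun x y => e y x) Y X.
Proof.
have sumE (e' : rel T) X' Y' :
    pairs e' X' Y' = \sum_(x in X') \sum_(y in Y') e' x y.
  by apply: eq_bigr => x _; rewrite /deg -sum1dep_card -big_mkcondr.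
by rewrite !sumE exchange_big.
Qed.

Lemma pairs_le e X Y L : {in X, forall x, L * deg e x Y <= #|Y|} ->
  L * pairs e X Y <= #|X| * #|Y|.
Proof. by move=> le; rewrite big_distrr -sum_nat_const; apply: leq_sum. Qed.
End Counting.

Definition nonedge (T : tournament) : rel T := fun x y => ~~ edge x y.
Arguments nonedge : clear implicits.

(** For nonempty sets this is density at least 1 - 1/L, without division. *)
Definition almost_complete (T : tournament) (L : nat) (A B : {set T}) :=
  L * pairs (nonedge T) A B <= #|A| * #|B|.

(* The required density 1 - 1/Lam(N) may depend on the relative size 1/N. *)
Definition dense_pair (T : tournament) (Lam : nat -> nat) (M : nat)
    (X : {set T}) : Prop :=
  exists N (A B : {set T}),
  [/\ N <= M, [/\ A \subset X, B \subset X & [disjoint A & B]],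
      #|X| <= N * #|A|, #|X| <= N * #|B| & almost_complete (Lam N) A B].

Lemma dense_pair_leq (T : tournament) Lam M M' (X : {set T}) : M <= M' ->
  dense_pair Lam M X -> dense_pair Lam M' X.
Proof.
by move=> MM [N [A [B [NM]]]] *; exists N, A, B; split=> //; apply: leq_trans MM.
Qed.

(** Each vertex w still to be embedded has a candidate set [U w]. The image of u should leave a
    1/[Lam N] share of every other candidate set. If the vertices that fail this for some w are
    many, they form with [U w] a dense pair; otherwise some image works for all w, and the induction
    continues with smaller candidate sets. *)
Lemma greedy_embedding (H : tournament) (Lam : nat -> nat) (s : seq H) :
  uniq s -> forall N0, exists M, forall (T : tournament) (X : {set T})
    (U : H -> {set T}), M <= #|X| ->
  (forall u, u \in s -> U u \subset X /\ #|X| <= N0 * #|U u|) ->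
  {in s &, forall u w, u != w -> [disjoint U u & U w]} ->
  dense_pair Lam M X \/
  exists phi : H -> T, forall u, u \in s -> phi u \in U u /\
    forall w, w \in s -> edge (phi u) (phi w) = edge u w.
Proof.
elim: s => [|u s IH] /=.
  move=> _ N0; exists 1 => T X U /card_gt0P[x _] _ _; right.
  by exists (fun=> x).
(* With this N, [size s] bad sets of size below |X|/N cannot cover [U u], which has size at least
   |X|/N0. *)
move=> /andP[us uqs] N0; pose N := N0 * (size s).+1.
have {IH} [M IH] := IH uqs (N0 * Lam N); exists (maxn 1 (maxn N M)) => T X U.
rewrite !geq_max => /and3P[X0 NX MX] UX Udis.
have [UuX Xu] := UX u (mem_head _ _).
pose good w x := [set y in U w | edge x y == edge u w].
pose bad w := [set x in U u | Lam N * #|good w x| < #|U w|].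
have [[w ws Nbad]|nobad] := pselect (exists2 w, w \in s & #|X| <= N * #|bad w|).
  left; apply: (@dense_pair_leq _ _ N); first by rewrite !leq_max leqnn orbT.
  have wus : w \in u :: s by rewrite inE ws orbT.
  have uw : u != w by apply: contraNneq us => ->.
  have [UwX Xw] := UX w wus.
  have bX : bad w \subset X.
    by apply: subset_trans UuX; apply/subsetP => x; rewrite inE => /andP[].
  have dis : [disjoint bad w & U w].
    apply: disjointWl (Udis u w (mem_head _ _) wus uw).
    by apply/subsetP => x; rewrite inE => /andP[].
  have NUw : #|X| <= N * #|U w|.
    by apply: leq_trans Xw _; rewrite leq_mul2r leq_pmulr ?orbT.
  have degle e : {in bad w & U w, forall x y, e x y = (edge x y == edge u w)} ->
      Lam N * pairs e (bad w) (U w) <= #|bad w| * #|U w|.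
    move=> ee; rewrite (eq_pairs (e' := fun x y => edge x y == edge u w)) //.
    by apply: pairs_le => x; rewrite inE => /andP[_] /ltnW.
  (* Few good neighbours means that almost all edges run against the orientation of uw, so that
     orientation decides which set comes first. *)
  case: (boolP (edge u w)) => euw.
    exists N, (U w), (bad w); split=> //; first by rewrite disjoint_sym.
    rewrite /almost_complete pairsC mulnC [leqRHS]mulnC mulnC; apply: degle.
    move=> x y xb yU; rewrite euw eqb_id /nonedge -edge_tour //.
    by apply: contraTneq dis => exy; apply/pred0Pn; exists x; rewrite /= xb exy.
  exists N, (bad w), (U w); split=> //; apply: degle => x y _ _.
  by rewrite /nonedge (negbTE euw) eqbF_neg.
have [x xU xgood] : exists2 x, x \in U u &
    forall w, w \in s -> #|U w| <= Lam N * #|good w x|.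
  have [|] := boolP (U u \subset \bigcup_(w <- s) bad w).
    move=> /subset_leq_card le; exfalso.
    have lesum : #|\bigcup_(w <- s) bad w| <= \sum_(w <- s) #|bad w|.
      exact: card_bigcup_leq.
    have le2 : N * #|U u| <= size s * #|X|.
      apply: leq_trans (_ : N * \sum_(w <- s) #|bad w| <= _).
        by rewrite leq_mul2l (leq_trans le) ?orbT.
      rewrite big_distrr /= mulnC -iter_addn_0 -(count_predT s) -big_const_seq.
      rewrite big_seq [leqRHS]big_seq; apply: leq_sum => w ws.
      by rewrite leqNgt; apply/negP => lt; apply: nobad; exists w => //; apply: ltnW.
    have := leq_mul (leqnn (size s).+1) Xu.
    rewrite mulnA [_ * N0]mulnC -/N => /leq_trans/(_ le2).
    by rewrite mulSn -[leqRHS]add0n leq_add2r leqNgt X0.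
  case/subsetPn => x xU xnb; exists x => // w ws.
  rewrite leqNgt; apply: contra xnb => lt.
  by rewrite (big_rem w ws) /= inE; apply/orP; left; rewrite inE xU.
have [||dp|[phi phiP]] := IH T X (good ^~ x) MX.
- move=> w ws; have [UwX Xw] := UX w (mem_behead (s := u :: s) ws); split.
    by apply: subset_trans UwX; apply/subsetP => y; rewrite inE => /andP[].
  by apply: leq_trans Xw _; rewrite -mulnA leq_mul2l xgood ?orbT.
- move=> w z ws zs wz.
  apply: disjointWl (disjointWr _ (Udis w z (mem_behead (s := u :: s) ws)
    (mem_behead (s := u :: s) zs) wz)).
    by apply/subsetP => y; rewrite inE => /andP[].
  by apply/subsetP => y; rewrite inE => /andP[].
- by left; apply: dense_pair_leq dp; rewrite !leq_max leqnn !orbT.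
right; exists (fun z => if z == u then x else phi z).
have xphi w : w \in s -> edge x (phi w) = edge u w.
  by case/phiP; rewrite inE => /andP[_ /eqP->].
have Uphi w : w \in s -> phi w \in U w.
  by case/phiP; rewrite inE => /andP[].
have su w : w \in s -> w == u = false.
  by move=> ws; apply: contraNF us => /eqP<-.
move=> w; rewrite inE => /predU1P[->|ws].
  rewrite eqxx; split=> // z; rewrite inE => /predU1P[->|zs].
    by rewrite eqxx !edge_irr.
  by rewrite su // xphi.
rewrite su //; split; first exact: Uphi.
move=> z; rewrite inE => /predU1P[->|zs]; last by rewrite su // (phiP w ws).2.
rewrite eqxx edge_tour; last first.
  have := Udis u w (mem_head _ _) (mem_behead (s := u :: s) ws).
  rewrite eq_sym su // => /(_ isT) dis.
  apply: contraTneq dis => eq; apply/pred0Pn; exists x.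
  by rewrite /= xU -eq Uphi.
by rewrite xphi // -edge_tour // su.
Qed.

(** The initial candidate sets are disjoint slices of X of equal size; rounding down costs a factor
    2. *)
Lemma exists_dense_pair (H : tournament) (Lam : nat -> nat) :
  exists M, forall (T : tournament) (X : {set T}), ~ contains T H ->
  M <= #|X| -> dense_pair Lam M X.
Proof.
have [M HM] := greedy_embedding Lam (enum_uniq H) (2 * #|H|).
exists (maxn #|H| M) => T X free; rewrite geq_max => /andP[HX MX].
pose k := #|X| %/ #|H|.
pose U (u : H) := [set x in chop (enum X) k (enum_rank u)].
have cU u : #|U u| = k.
  rewrite cardsE (card_uniqP _) ?take_uniq ?drop_uniq ?enum_uniq //.
  rewrite (@size_chop _ _ #|H|) // -cardE mulnC; exact: leq_trunc_div.
have Udis : {in enum H &, forall u w, u != w -> [disjoint U u & U w]}.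
  have lt (u w : H) : enum_rank u < enum_rank w -> [disjoint U u & U w].
    move=> uw; apply/pred0Pn => -[x /andP[]] /=; rewrite !inE => xu xw.
    by have := chop_neq (enum_uniq X) uw xu xw; rewrite eqxx.
  move=> u w _ _ uw; have := contra_neq (@enum_rank_inj _ u w) uw.
  by rewrite -val_eqE /= neq_ltn => /orP[/lt//|/lt]; rewrite disjoint_sym.
case: (HM T X U MX _ Udis) => [u _|dp|[phi phiP]].
- split; first by apply/subsetP => x; rewrite inE => /chop_sub; rewrite mem_enum.
  by rewrite cU leq_divn_double //; apply/card_gt0P; exists u.
- by apply: dense_pair_leq dp; rewrite leq_maxr.
case: free; exists phi; split; last by move=> u w; apply: (phiP u _).2; rewrite mem_enum.
move=> u w eq; apply: contraTeq isT => uw.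
have /pred0P/(_ (phi u)) := Udis u w (mem_enum _ _) (mem_enum _ _) uw.
by rewrite /= (phiP u (mem_enum _ _)).1 eq (phiP w (mem_enum _ _)).1.
Qed.

(** Take a dense pair (A, B) and recurse inside B. The final N is a product N1 * N2 whose second
    factor is unknown when the pair is chosen, but it is bounded by [g N1], so the density demanded
    of the pair can anticipate it. *)
Lemma exists_dense_sequence (H : tournament) k (Lam : nat -> nat) :
  {homo Lam : a b / a <= b} ->
  exists M, forall (T : tournament) (X : {set T}), ~ contains T H ->
  M <= #|X| -> exists N (A : nat -> {set T}),
  [/\ 0 < N <= M, forall i, i < k -> A i \subset X /\ #|X| <= N * #|A i| &
      forall i j, i < j < k ->
        [disjoint A i & A j] /\ almost_complete (Lam N) (A i) (A j)].
Proof.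
elim: k Lam => [|k IH] Lam Lmono.
  exists 1 => T X _ X1; exists 1, (fun=> set0); split=> // i j.
  by rewrite ltn0 andbF.
have IHN N1 : exists M, forall (T : tournament) (X : {set T}), ~ contains T H ->
  M <= #|X| -> exists N (A : nat -> {set T}),
  [/\ 0 < N <= M, forall i, i < k -> A i \subset X /\ #|X| <= N * #|A i| &
      forall i j, i < j < k ->
        [disjoint A i & A j] /\ almost_complete (Lam (N1 * N)) (A i) (A j)].
  by apply: (IH (fun N => Lam (N1 * N))) => a b ab; rewrite Lmono // leq_mul2l ab orbT.
have [g gP] := choice IHN.
(* The factor [g N1] pays for passing from B to a subset of relative size 1/N2; monotonicity of
   [Lam] covers all N2 up to [g N1]. *)
have [M1 M1P] := exists_dense_pair H (fun N1 => g N1 * Lam (N1 * g N1)).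
pose M := \max_(N1 < M1.+1) (N1 * g N1).
have leM N1 : N1 <= M1 -> N1 * g N1 <= M.
  by move=> le; apply: (leq_bigmax (Ordinal (le : N1 < M1.+1))).
exists (maxn 1 (maxn M1 M)) => T X free; rewrite !geq_max => /and3P[X0 M1X MX].
have [N1 [A [B [NM1 [AX BX AB] XA XB dense]]]] := M1P T X free M1X.
have N10 : 0 < N1 by rewrite lt0n; apply: contraTneq XA => ->; rewrite -ltnNge.
have gB : g N1 <= #|B|.
  rewrite -(leq_pmul2l N10); apply: leq_trans XB.
  exact: leq_trans (leM _ NM1) MX.
have [N2 [C [/andP[N20 N2g] CB Cdense]]] := gP N1 T B free gB.
exists (N1 * N2), (fun i => if i is i'.+1 then C i' else A); split.
- rewrite muln_gt0 N10 N20 !leq_max (leq_trans _ (leM _ NM1)) ?orbT //.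
  by rewrite leq_mul2l N2g orbT.
- case=> [_|i ik].
    split=> //; apply: leq_trans XA _.
    by rewrite leq_mul2r leq_pmulr ?orbT.
  have [CiB BCi] := CB i ik; split; first exact: subset_trans BX.
  by apply: leq_trans XB _; rewrite -mulnA leq_mul2l BCi orbT.
case=> [|i] [|j] //; rewrite !ltnS; last exact: Cdense.
move=> /= jk; have [CjB BCj] := CB j jk; split; first exact: disjointWr AB.
have g0 : 0 < g N1 by apply: leq_trans N2g.
rewrite /almost_complete -(leq_pmul2l g0).
apply: leq_trans (_ : g N1 * Lam (N1 * g N1) * pairs (nonedge T) A B <= _).
  rewrite mulnA leq_mul // ?pairs_sub // leq_mul2l Lmono ?orbT //.
  by rewrite leq_mul2l N2g orbT.
apply: leq_trans dense _; rewrite mulnCA leq_mul2l (leq_trans BCj) ?orbT //.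
by rewrite leq_mul2r N2g orbT.
Qed.

(** * Families of blocks *)

Section Families.
Variables (T : tournament) (m : nat).
Implicit Types (i j t : 'I_m) (S A : 'I_m -> {set T}) (X Y : {set T}).

(* Edges running against the order of the blocks that contain their ends. *)
Definition against i j : rel T :=
  fun x y => if i < j then ~~ edge x y else ~~ edge y x.

Lemma againstC i j x y : i != j -> against i j x y = against j i y x.
Proof.
rewrite /against -val_eqE neq_ltn => /orP[] ij; rewrite ij ltnNge ltnW //.
Qed.

Lemma pairs_against i j X Y : i != j ->
  pairs (against i j) X Y = pairs (against j i) Y X.
Proof. by move=> ij; rewrite pairsC; apply: eq_pairs => x y _ _; apply: againstC. Qed.

Definition all_dense L S := forall i j, i != j ->
  L * pairs (against i j) (S i) (S j) <= #|S i| * #|S j|.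

Lemma all_dense_lt L S :
  (forall i j, i < j -> almost_complete L (S i) (S j)) -> all_dense L S.
Proof.
move=> H; have {}H i j : i < j -> L * pairs (against i j) (S i) (S j) <= #|S i| * #|S j|.
  move=> ij; have := H i j ij; rewrite /almost_complete (eq_pairs (e' := against i j)) //.
  by move=> x y _ _; rewrite /against ij.
move=> i j ij; move: (ij); rewrite -val_eqE neq_ltn => /orP[/H//|/H].
by rewrite pairs_against 1?eq_sym // [_ * #|S i|]mulnC.
Qed.

(** Markov's inequality: for each j at most a 1/(2m) share of [S t] has too many wrong edges to
    [S j], so the union over j removes at most half. *)
Lemma prune L S t :
  (forall j, t != j ->
     (L * (2 * m)) * pairs (against t j) (S t) (S j) <= #|S t| * #|S j|) ->
  exists X, [/\ X \subset S t, #|S t| <= 2 * #|X| &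
    forall x, x \in X -> forall j, t != j ->
      L * deg (against t j) x (S j) <= #|S j|].
Proof.
move=> dense.
pose bad j := [set x in S t | (t != j) && (#|S j| < L * deg (against t j) x (S j))].
have m0 : 0 < m by apply: leq_trans (ltn_ord t).
have lebad j : 2 * m * #|bad j| <= #|S t|.
  have [tj|tj] := boolP (t != j); last first.
    rewrite (_ : bad j = set0) ?cards0 ?muln0 //.
    by apply/setP => x; rewrite !inE (negbTE tj) andbF.
  have [Sj0|Sj0] := posnP #|S j|.
    rewrite (_ : bad j = set0) ?cards0 ?muln0 //.
    apply/setP => x; rewrite !inE (cards0_eq Sj0) (_ : deg _ _ _ = 0).
      by rewrite muln0 cards0 ltnn !andbF.
    by apply/eqP; rewrite cards_eq0; apply/eqP/setP => y; rewrite !inE.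
  rewrite -(leq_pmul2r Sj0) -mulnA; apply: leq_trans (dense j tj).
  rewrite [L * _]mulnC -[leqRHS]mulnA leq_mul2l; apply/orP; right.
  apply: leq_trans (_ : L * pairs (against t j) (bad j) (S j) <= _).
    rewrite big_distrr -sum_nat_const; apply: leq_sum => x.
    by rewrite inE => /and3P[_ _ /ltnW].
  by rewrite leq_mul2l pairs_sub ?orbT //; apply/subsetP => x; rewrite inE => /andP[].
pose B := \bigcup_j bad j.
have leB : 2 * #|B| <= #|S t|.
  have le1 : #|B| <= \sum_j #|bad j|.
    rewrite /B; exact: card_bigcup_leq.
  rewrite -(leq_pmul2l m0); apply: leq_trans (_ : \sum_(j < m) #|S t| <= _); last first.
    by rewrite sum_nat_const card_ord.
  apply: leq_trans (_ : 2 * m * \sum_j #|bad j| <= _).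
    by rewrite mulnA [m * 2]mulnC leq_mul2l le1 orbT.
  by rewrite big_distrr; apply: leq_sum => j _; apply: lebad.
have BS : B \subset S t by apply/bigcupsP => j _; apply/subsetP => x; rewrite inE => /andP[].
exists (S t :\: B); split; first exact: subsetDl.
  by rewrite cardsD (setIidPr BS); lia.
move=> x /setDP[xS xB] j tj; rewrite leqNgt; apply: contra xB => lt.
by apply/bigcupP; exists j; rewrite // inE xS tj.
Qed.

(** After pruning, every single vertex of the block is well joined to the other blocks, so density
    survives passing to a transitive subset, however small. Each replacement costs a factor 2m in
    the density. *)
Lemma transitive_replacement (v : pred 'I_m) L N (s : seq 'I_m) A :
  (forall X, #|T| <= 2 * N * #|X| ->
     exists Y, [/\ Y \subset X, transitive_set Y & tr T <= 2 * #|Y|]) ->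
  uniq s -> (forall i, i \in s -> #|T| <= N * #|A i|) ->
  all_dense (L * (2 * m) ^ size s) A ->
  exists S, [/\ forall i, S i \subset A i,
    forall i, i \in s -> v i -> transitive_set (S i) /\ tr T <= 2 * #|S i|,
    forall i, (i \notin s) || ~~ v i -> S i = A i &
    all_dense L S].
Proof.
move=> large; elim: s L A => [|t s IH] L A /=.
  by rewrite muln1 => _ _ AL; exists A.
move=> /andP[ts us] sz dense; have m0 : 0 < m by apply: leq_trans (ltn_ord t).
rewrite expnSr mulnA in dense; set L' := L * _ in dense.
have denseA : all_dense L' A.
  move=> i j ij; apply: leq_trans (dense i j ij); rewrite leq_mul2r leq_pmulr ?orbT //.
  by rewrite muln_gt0.
have [vt|vt] := boolP (v t); last first.
  have [|S [SA Str SE SL]] := IH _ _ us _ denseA.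
    by move=> i si; apply: sz; rewrite inE si orbT.
  exists S; split=> // i; rewrite inE.
    by move=> /predU1P[->|/Str]; rewrite ?(negbTE vt).
  by rewrite negb_or => /orP[/andP[_ si]|vi]; rewrite SE ?si ?vi ?orbT.
have [X [XA AX Xdeg]] := prune (dense t).
have [|Y [YX Ytr Ylarge]] := large X.
  apply: leq_trans (sz t (mem_head _ _)) _.
  by rewrite [2 * N]mulnC -mulnA leq_mul2l AX orbT.
pose A1 i := if i == t then Y else A i.
have A1t : A1 t = Y by rewrite /A1 eqxx.
have A1i i : i != t -> A1 i = A i by rewrite /A1 => /negbTE->.
have dt j : t != j -> L' * pairs (against t j) (A1 t) (A1 j) <= #|A1 t| * #|A1 j|.
  rewrite eq_sym => tj; rewrite A1t A1i //; apply: pairs_le => x xY.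
  by apply: Xdeg; rewrite 1?eq_sym ?(subsetP YX).
have dA1 : all_dense L' A1.
  move=> i j ij; have [it|it] := eqVneq i t; first by move: ij; rewrite it; apply: dt.
  have [jt|jt] := eqVneq j t; last by rewrite !A1i //; apply: denseA.
  by move: ij; rewrite jt => ij; rewrite pairs_against // mulnC mulnC [leqRHS]mulnC dt 1?eq_sym.
have [i si|S [SA Str SE SL]] := IH _ _ us _ dA1.
  by rewrite A1i ?sz ?inE ?si ?orbT //; apply: contraNneq ts => <-.
exists S; split=> // i.
- apply: subset_trans (SA i) _; rewrite /A1; case: eqP => // ->.
  exact: subset_trans XA.
- rewrite inE => /predU1P[->|/Str//] _.
  by rewrite SE ?ts // A1t.
- rewrite inE negb_or => H; have it : i != t.
    by case/orP: H => [/andP[]//|]; apply: contraNneq => ->.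
  by rewrite SE ?A1i //; case/orP: H => [/andP[_ ->]//|->]; rewrite orbT.
Qed.

(** All blocks are pruned at once; the extra factor 2 in the hypothesis absorbs the halving of the
    set into which degrees are measured. *)
Lemma prune_all L S : all_dense (2 * L * (2 * m)) S ->
  exists S', [/\ forall i, S' i \subset S i, forall i, #|S i| <= 2 * #|S' i| &
    forall i j x, i != j -> x \in S' i -> L * deg (against i j) x (S' j) <= #|S' j|].
Proof.
move=> dense.
have /choice[S' S'P] : forall t, exists X, [/\ X \subset S t, #|S t| <= 2 * #|X| &
    forall x, x \in X -> forall j, t != j ->
      2 * L * deg (against t j) x (S j) <= #|S j|].
  by move=> t; apply: prune => j tj; apply: dense.
exists S'; split=> [i|i|i j x ij xS]; try by case: (S'P i).
have [_ _ /(_ x xS j ij) le] := S'P i; have [sub half _] := S'P j.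
rewrite -(leq_pmul2l (ltn0Sn 1)); apply: leq_trans half; apply: leq_trans le.
by rewrite mulnA leq_mul2l deg_sub ?orbT.
Qed.

Variables (v : pred 'I_m) (q : 'I_m -> nat).
Implicit Type P : 'I_m -> nat -> {set T}.

Definition block P i := \bigcup_(p < q i) P i p.

Record block_family C P : Prop := Family {
  family_disjoint : forall i j p p', i != j -> [disjoint P i p & P j p'];
  family_complete : forall i p p', p < p' < q i -> complete_to (P i p) (P i p');
  family_transitive : forall i, v i -> transitive_set (block P i);
  family_tr : forall i p, v i -> p < q i -> tr T <= C * #|P i p|;
  family_linear : forall i p, ~~ v i -> p < q i -> #|T| <= C * #|P i p|
}.

(** The bound is per vertex and per part: it can be applied to each vertex of an embedded copy, and
    it survives halving of the parts. *)
Definition regular L P := forall i j p p' x, i != j -> p < q i -> p' < q j ->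
  x \in P i p -> L * deg (against i j) x (P j p') <= #|P j p'|.

Lemma family_shrink C P P' :
  (forall i p, P' i p \subset P i p) ->
  (forall i p, p < q i -> #|P i p| <= 2 * #|P' i p|) ->
  block_family C P -> block_family (2 * C) P'.
Proof.
move=> sub half [dis comp trans large lin]; split.
- by move=> i j p p' /dis d; apply: disjointWl (disjointWr _ (d p p')).
- move=> i p p' /comp cpl x y /(subsetP (sub _ _)) xP /(subsetP (sub _ _)).
  exact: cpl.
- move=> i /trans; apply: transitive_set_sub; apply/bigcupsP => p _.
  by apply: subset_trans (sub _ _) _; apply: bigcup_sup.
- move=> i p vi pq; apply: leq_trans (large _ _ vi pq) _.
  by rewrite [2 * C]mulnC -mulnA leq_mul2l half ?orbT.
- move=> i p vi pq; apply: leq_trans (lin _ _ vi pq) _.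
  by rewrite [2 * C]mulnC -mulnA leq_mul2l half ?orbT.
Qed.

Lemma regular_shrink L P P' :
  (forall i p, P' i p \subset P i p) ->
  (forall i p, p < q i -> #|P i p| <= 2 * #|P' i p|) ->
  regular (2 * L) P -> regular L P'.
Proof.
move=> sub half reg i j p p' x ij pq p'q /(subsetP (sub _ _)) xP.
have := reg i j p p' x ij pq p'q xP; have := half j p' p'q.
have := deg_sub (against i j) x (sub j p').
set d' := deg _ _ _; set d := deg _ _ _ => dd h r.
have : L * d' <= L * d by rewrite leq_mul2l dd orbT.
by move: r; rewrite -mulnA; lia.
Qed.

Lemma chop_family C S : (forall i, 0 < q i) -> (forall i, ~~ v i -> q i = 1) ->
  (forall i j, i != j -> [disjoint S i & S j]) ->
  (forall i, v i -> transitive_set (S i) /\ q i <= #|S i|) ->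
  (forall i, v i -> tr T <= C * #|S i|) -> (forall i, ~~ v i -> #|T| <= C * #|S i|) ->
  exists P, [/\ forall Q, (forall i, q i <= Q) -> block_family (2 * Q * C) P,
    forall i p, P i p \subset S i &
    forall i p, p < q i -> #|S i| <= 2 * q i * #|P i p|].
Proof.
move=> q0 q1 dis trans large lin.
have /choice[P PP] : forall i, exists P : nat -> {set T},
    [/\ forall p, P p \subset S i,
        forall p p', p < p' < q i -> complete_to (P p) (P p') &
        forall p, p < q i -> #|S i| <= 2 * q i * #|P p|].
  move=> i; have [vi|vi] := boolP (v i); last first.
    exists (fun=> S i); split=> [p|p p'|p _] //; rewrite q1 //; first by lia.
    by rewrite leq_pmull.
  have [tS qS] := trans i vi.
  have := @chop_transitive _ _ (#|S i| %/ q i) (q i) tS.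
  rewrite mulnC leq_trunc_div => /(_ isT)[P [PS cP comp]]; exists P; split=> //.
    by move=> p p' /andP[pp _]; apply: comp.
  by move=> p pq; rewrite cP // leq_divn_double.
have PS i p : P i p \subset S i by have [] := PP i.
have Pc i p : p < q i -> #|S i| <= 2 * q i * #|P i p|.
  by have [_ _] := PP i; apply.
exists P; split=> // Q leQ.
have PQ i p : p < q i -> C * #|S i| <= 2 * Q * C * #|P i p|.
  move=> pq; rewrite [2 * Q * C]mulnC -mulnA leq_mul2l (leq_trans (Pc i p pq)) ?orbT //.
  by rewrite leq_mul2r leq_mul2l leQ !orbT.
split.
- by move=> i j p p' /dis d; apply: disjointWl (disjointWr _ d).
- by move=> i p p' pp; have [_ h _] := PP i; apply: h.
- move=> i /trans[tS _]; apply: transitive_set_sub tS.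
  by apply/bigcupsP => p _.
- by move=> i p vi pq; apply: leq_trans (large i vi) (PQ i p pq).
- by move=> i p vi pq; apply: leq_trans (lin i vi) (PQ i p pq).
Qed.

(** In the hypotheses, 2N allows for the halving before a transitive subset is taken, and 4Q <= tr T
    leaves at least Q vertices in each transitive block for the cut. A part is at least a 1/(2Q)
    share of its block, hence the factors 2Q in the density and in the size constant. *)
Lemma exists_regular_family L N Q A :
  0 < N -> (forall i, 0 < q i <= Q) -> (forall i, ~~ v i -> q i = 1) ->
  4 * Q <= tr T ->
  (forall X, #|T| <= 2 * N * #|X| ->
     exists Y, [/\ Y \subset X, transitive_set Y & tr T <= 2 * #|Y|]) ->
  (forall i, #|T| <= N * #|A i|) ->
  (forall i j, i != j -> [disjoint A i & A j]) ->
  all_dense (2 * (L * (2 * Q)) * (2 * m) * (2 * m) ^ m) A ->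
  exists P, block_family (2 * Q * (4 * N)) P /\ regular L P.
Proof.
move=> N0 qQ q1 trQ large sz dis dense.
have [||S [SA Str SE SL]] := @transitive_replacement v
    (2 * (L * (2 * Q)) * (2 * m)) N (enum 'I_m) A large (enum_uniq _).
- by move=> i _.
- by rewrite size_enum_ord.
have [S' [S'S half reg]] := prune_all SL.
have trS i : v i -> tr T <= 4 * #|S' i|.
  move=> vi; have [_ le] := Str i (mem_enum _ _) vi.
  by have := half i; lia.
have [||i j ij|i vi|i vi|i vi|P [fam PS' large']] := @chop_family (4 * N) S'.
- by move=> i; case/andP: (qQ i).
- exact: q1.
- by apply: disjointWl (disjointWr _ (dis i j ij)); apply: subset_trans (S'S _) (SA _).
- have [tS _] := Str i (mem_enum _ _) vi; split; first exact: transitive_set_sub tS.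
  by have := trS i vi; have := qQ i; lia.
- by apply: leq_trans (trS i vi) _; rewrite leq_mul2r leq_pmulr ?orbT.
- apply: leq_trans (sz i) _; have := half i; rewrite SE ?vi ?orbT // => h.
  by apply: leq_trans (_ : N * (2 * #|S' i|) <= _); [rewrite leq_mul2l h orbT|lia].
exists P; split; first by apply: fam => i; case/andP: (qQ i).
move=> i j p p' x ij pq p'q /(subsetP (PS' _ _)) xS.
have := reg i j x ij xS; have := large' j p' p'q.
have := deg_sub (against i j) x (PS' j p').
set d' := deg _ _ _; set d := deg _ _ _ => dd h r.
have /andP[q0 leQ] := qQ j.
have Q0 : 0 < 2 * Q by lia.
rewrite -(leq_pmul2l Q0); apply: leq_trans (_ : L * (2 * Q) * d <= _).
  by rewrite mulnA [2 * Q * L]mulnC leq_mul2l dd orbT.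
apply: leq_trans r (leq_trans h _).
by rewrite leq_mul2r leq_mul2l leQ !orbT.
Qed.

Lemma card_block C P i : block_family C P -> #|block P i| = \sum_(p < q i) #|P i p|.
Proof.
move=> [_ comp _ _ _]; rewrite -sum1_card partition_disjoint_bigcup => [|p p'].
  by apply: eq_bigr => p _; rewrite sum1_card.
have lt (a b : 'I_(q i)) : a < b -> [disjoint P i a & P i b].
  move=> ab; apply/pred0Pn => -[x /andP[/= xa xb]].
  by have := comp i a b _ x x xa xb; rewrite ab ltn_ord edge_irr => /(_ isT).
by rewrite -val_eqE neq_ltn => /orP[/lt//|/lt]; rewrite disjoint_sym.
Qed.

Lemma regular_blocks C L P i j : block_family C P -> regular L P -> i < j ->
  almost_complete L (block P i) (block P j).
Proof.
move=> fam reg ij; rewrite /almost_complete (eq_pairs (e' := against i j)); last first.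
  by move=> x y _ _; rewrite /against ij.
apply: pairs_le => x /bigcupP[p _ xp]; rewrite (card_block _ fam).
have nij : i != j by rewrite -val_eqE neq_ltn ij.
apply: leq_trans (_ : L * \sum_(p' < q j) deg (against i j) x (P j p') <= _).
  rewrite leq_mul2l; apply/orP; right; rewrite /deg.
  rewrite (_ : finset _ = \bigcup_(p' < q j) [set y in P j p' | against i j x y]).
    exact: card_bigcup_leq.
  apply/setP => y; rewrite inE; apply/andP/bigcupP.
    by case=> /bigcupP[p' _ yp] bad; exists p'; rewrite // inE yp.
  by case=> p' _; rewrite inE => /andP[yp ->]; split=> //; apply/bigcupP; exists p'.
by rewrite big_distrr; apply: leq_sum => p' _; apply: reg nij (ltn_ord p) (ltn_ord p') xp.
Qed.
End Families.

(** * From families of blocks to m-sequences *)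

Lemma card_edges_between (T : tournament) (X Y : {set T}) :
  (#|edges_between X Y| + pairs (nonedge T) X Y = #|X| * #|Y|)%N.
Proof.
have -> : #|edges_between X Y| = pairs (@edge T) X Y.
  rewrite /pairs /deg -sum1_card (eq_bigr (fun x => \sum_(y in Y | edge x y) 1)%N).
    rewrite pair_big_dep; apply: eq_bigl => -[x y].
    by rewrite !inE /= andbA.
  by move=> x _; rewrite sum1dep_card.
rewrite /pairs -big_split /= -sum_nat_const; apply: eq_bigr => x _.
rewrite /deg -(cardsID [set y | edge x y] Y); congr (_ + _)%N.
  by apply: eq_card => y; rewrite !inE.
by apply: eq_card => y; rewrite !inE andbC.
Qed.

(** Division by zero gives 0, so an empty side forces density 0. *)
Lemma card_gt0_density (R : realType) (T : tournament) (X Y : {set T}) :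
  density R X Y = 1%R -> (0 < #|X|)%N /\ (0 < #|Y|)%N.
Proof.
rewrite /density; have [->|X0] := posnP #|X|.
  by rewrite mul0r invr0 mulr0 => /esym/eqP; rewrite oner_eq0.
have [->|Y0] := posnP #|Y|; last by [].
by rewrite mulr0 invr0 mulr0 => /esym/eqP; rewrite oner_eq0.
Qed.

Lemma density1_complete (R : realType) (T : tournament) (X Y : {set T}) :
  density R X Y = 1%R -> complete_to X Y.
Proof.
move=> d1; have [X0 Y0] := card_gt0_density d1.
have : #|edges_between X Y| = (#|X| * #|Y|)%N.
  apply/eqP; rewrite -(eqr_nat R) natrM; apply/eqP.
  by apply: (divr1_eq (x := _)); move: d1; rewrite /density.
rewrite -card_edges_between -[LHS]addn0 => /eqP; rewrite eqn_add2l eq_sym.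
rewrite sum_nat_eq0 => /forall_inP H x y xX yY.
have := H x xX; rewrite cards_eq0 => /eqP/setP/(_ y).
by rewrite !inE yY => /negbT; rewrite negbK.
Qed.

Lemma almost_complete_density (R : realType) (T : tournament) L (X Y : {set T}) :
  (0 < L)%N -> (0 < #|X|)%N -> (0 < #|Y|)%N -> almost_complete L X Y ->
  (1 - L%:R^-1 <= density R X Y)%R.
Proof.
move=> L0 X0 Y0 ac; rewrite /density -natrM ler_pdivlMr ?ltr0n ?muln_gt0 ?X0 //.
rewrite -card_edges_between natrD mulrBl mul1r lerBlDr lerD2l.
rewrite ler_pdivlMl ?ltr0n // -natrM -natrD card_edges_between ler_nat.
exact: ac.
Qed.

Section MSequences.
Variables (m : nat) (v : m.-tuple bool) (eta : (zeta v m).-tuple nat).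

(** A linear block counts as having a single part, so that both kinds of block are treated alike. *)
Definition parts_count (i : 'I_m) :=
  if tnth v i then nth 0%N eta (zeta v i.+1).-1 else 1%N.

Lemma parts_count_gt0 i : (forall n, n \in (eta : seq nat) -> (0 < n)%N) ->
  (0 < parts_count i)%N.
Proof.
move=> eta0; rewrite /parts_count; case: ifP => // vi; apply/eta0/mem_nth.
rewrite size_tuple prednK; last first.
  rewrite -has_count; apply/hasP; exists true => //.
  rewrite -vi (tnth_nth true) -[nth _ _ _](nth_take _ (ltnSn i)) mem_nth //.
  by rewrite size_takel ?size_tuple.
by rewrite /zeta [take m v]take_oversize ?size_tuple // leq_count_subseq ?take_subseq.
Qed.

Definition family_mseq (T : tournament) (P : 'I_m -> nat -> {set T}) : mseq T m :=
  MSeq (block parts_count P) (fun i => mkseq (P i) (parts_count i)).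

Lemma is_mseq_family (R : realType) (T : tournament) C L
    (P : 'I_m -> nat -> {set T}) :
  (forall n, n \in (eta : seq nat) -> (0 < n)%N) ->
  (0 < #|T|)%N -> (0 < C)%N -> (1 < L)%N ->
  block_family (tnth v) parts_count C P ->
  (forall i j : 'I_m, (i < j)%N ->
     almost_complete L (block parts_count P i) (block parts_count P j)) ->
  is_mseq eta (C%:R^-1 : R) L%:R^-1 (family_mseq P).
Proof.
move=> eta0 T0 C0 L1 fam ac; have L0 := ltnW L1.
have q0 i := parts_count_gt0 i eta0.
have C0R : (0 < C%:R :> R)%R by rewrite ltr0n.
have P0 i p : (p < parts_count i)%N -> (0 < #|P i p|)%N.
  move=> pq; have [vi|vi] := boolP (tnth v i).
    have := leq_trans (tr_gt0 T0) (family_tr fam vi pq).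
    by rewrite muln_gt0 => /andP[].
  have := leq_trans T0 (family_linear fam vi pq).
  by rewrite muln_gt0 => /andP[].
have B0 i : (0 < #|block parts_count P i|)%N.
  apply: leq_trans (P0 i 0%N (q0 i)) _; apply: subset_leq_card.
  exact: (bigcup_sup (Ordinal (q0 i))).
split=> /=.
- by rewrite invr_gt0.
- by rewrite invr_ge0 ler0n invf_lt1 ?ltr0n // ltr1n.
- move=> i j ij; rewrite disjoints_subset; apply/bigcupsP => p _.
  rewrite -disjoints_subset disjoint_sym disjoints_subset; apply/bigcupsP => p' _.
  by rewrite -disjoints_subset (family_disjoint fam) // eq_sym.
- exact: family_transitive fam.
- by move=> i vi; rewrite size_mkseq /parts_count vi.
- by move=> i _; rewrite big_map -{1}[parts_count i]subn0 big_mkord.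
- move=> i a b _; rewrite size_mkseq => /andP[ab bq].
  rewrite !nth_mkseq //; last exact: ltn_trans bq.
  apply/pred0Pn => -[x /andP[/= xa xb]].
  by have := family_complete fam _ xa xb; rewrite edge_irr ab bq => /(_ isT).
- move=> i a b _; rewrite size_mkseq => /andP[ab bq].
  rewrite !nth_mkseq //; last exact: ltn_trans bq.
  by apply: (family_complete fam); rewrite ab.
- move=> i X vi /mapP[p]; rewrite mem_iota /= => pq ->.
  by rewrite ler_pdivrMl // -natrM ler_nat; apply: (family_tr fam).
- move=> i vi; rewrite ler_pdivrMl // -natrM ler_nat.
  apply: leq_trans (family_linear fam vi (q0 i)) _.
  rewrite leq_mul2l; apply/orP; right; apply: subset_leq_card.
  exact: (bigcup_sup (Ordinal (q0 i))).
- by move=> i j ij; apply: almost_complete_density (ac i j ij).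
Qed.

Definition long_shape := [seq parts_count i | i <- enum 'I_m].

(** The long representation is a flattened list of lists, so a position decodes into a block index
    and an offset in it; a position out of range reads the default [set0], which has no member. *)
Lemma mem_long_rep (T : tournament) (P : 'I_m -> nat -> {set T}) a x :
  x \in nth set0 (long_rep v (family_mseq P)) a ->
  exists i : 'I_m, let p := reshape_offset long_shape a in
    [/\ reshape_index long_shape a = i, (p < parts_count i)%N & x \in P i p].
Proof.
have -> : long_rep v (family_mseq P) =
    flatten [seq mkseq (P i) (parts_count i) | i <- enum 'I_m].
  congr flatten; apply: eq_map => i /=; rewrite /block /parts_count.
  by case: (tnth v i); rewrite // big_ord1.
rewrite nth_flatten.
rewrite (_ : shape _ = long_shape); last first.
  by rewrite /shape -map_comp; apply: eq_map => i; rewrite /= size_mkseq.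
set r := reshape_index _ _; set p := reshape_offset _ _.
have [mr|rm] := leqP m r.
  by rewrite [nth [::] _ _]nth_default ?nth_nil ?inE // size_map size_enum_ord.
rewrite (nth_map (Ordinal rm)) ?size_enum_ord // (nth_ord_enum _ (Ordinal rm)).
have [qp|pq] := leqP (parts_count (Ordinal rm)) p.
  by rewrite nth_default ?inE // size_mkseq.
by rewrite nth_mkseq // => xP; exists (Ordinal rm).
Qed.

(** * Gluing a copy of the second factor to a copy of the first *)

Section Product.
Variables (T H1 H2 : tournament) (f1 : H1 -> nat) (f2 : H2 -> nat).
Variables (inj1 : injective f1) (inj2 : injective f2).
Variable orth : orthogonal_labels f1 f2.
Hypotheses (f1_gt0 : forall x, (0 < f1 x)%N) (f2_gt0 : forall y, (0 < f2 y)%N).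
Variables (C : nat) (P : 'I_m -> nat -> {set T}).
Hypothesis fam : block_family (tnth v) parts_count C P.
Variable phi : H1 -> T.
Hypothesis phi_emb : embedding phi.
Hypothesis phiP : forall h,
  phi h \in nth set0 (long_rep v (family_mseq P)) (f1 h).-1.

(** Copy vertices lying in block i itself impose no condition: there the edges are already ordered
    by completeness between parts. *)
Definition forward_part (i : 'I_m) p :=
  [set y in P i p | [forall h, forall j : 'I_m,
    (phi h \in block parts_count P j) ==> (j != i) ==> ~~ against j i (phi h) y]].

Lemma forward_part_sub i p : forward_part i p \subset P i p.
Proof. by apply/subsetP => y; rewrite inE => /andP[]. Qed.

(** A vertex of the copy lies in one block only, so by regularity it excludes at most a 1/L share of
    the part; all of them together exclude at most half. *)
Lemma forward_part_large L i p : (2 * #|H1| <= L)%N -> regular parts_count L P ->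
  (p < parts_count i)%N -> (#|P i p| <= 2 * #|forward_part i p|)%N.
Proof.
move=> HL reg pq.
have [H10|H10] := posnP #|H1|.
  rewrite (_ : forward_part i p = P i p) ?leq_pmull //.
  apply/setP => y; rewrite inE andb_idr // => _.
  by apply/forallP => h; have := card0_eq H10 h; rewrite inE.
pose bad h := [set y in P i p | [exists j : 'I_m,
  [&& phi h \in block parts_count P j, j != i & against j i (phi h) y]]].
have lebad h : (L * #|bad h| <= #|P i p|)%N.
  have [j [_ qj xj]] := mem_long_rep (phiP h).
  set p' := reshape_offset _ _ in qj xj.
  have [ji|ji] := eqVneq j i.
    rewrite (_ : bad h = set0) ?cards0 ?muln0 //; apply/setP => y.
    rewrite !inE; apply/negP => /andP[_ /existsP[k /and3P[/bigcupP[p'' _ xk] ki _]]].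
    have := family_disjoint fam p'' p' ki; rewrite -ji => /pred0P/(_ (phi h)).
    by rewrite /= xk xj.
  apply: leq_trans (reg j i p' p (phi h) ji qj pq xj).
  rewrite leq_mul2l; apply/orP; right; apply/subset_leq_card/subsetP => y.
  rewrite !inE => /andP[-> /existsP[k /and3P[/bigcupP[p'' _ xk] ki bad_k]]] /=.
  suff -> : j = k by [].
  apply/eqP/negP => /negP jk.
  have := family_disjoint fam p' p'' jk => /pred0P/(_ (phi h)).
  by rewrite /= xk xj.
have PU : P i p :\: forward_part i p = \bigcup_h bad h.
  apply/setP => y; rewrite !inE; apply/andP/bigcupP.
    case=> + yP; rewrite yP /= negb_forall => /existsP[h].
    rewrite negb_forall => /existsP[j]; rewrite !negb_imply andbT => ex.
    by exists h; rewrite // inE yP; apply/existsP; exists j.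
  case=> h _; rewrite inE => /andP[yP /existsP[j ex]]; rewrite yP; split=> //=.
  rewrite negb_forall; apply/existsP; exists h.
  by rewrite negb_forall; apply/existsP; exists j; rewrite !negb_imply andbT.
have le1 : (#|\bigcup_h bad h| <= \sum_h #|bad h|)%N.
  exact: card_bigcup_leq.
have le2 : (L * #|\bigcup_h bad h| <= #|H1| * #|P i p|)%N.
  apply: leq_trans (_ : L * \sum_h #|bad h| <= _)%N.
    by rewrite leq_mul2l le1 orbT.
  by rewrite big_distrr -sum_nat_const; apply: leq_sum => h _; apply: lebad.
have : (#|H1| * (2 * #|\bigcup_h bad h|) <= #|H1| * #|P i p|)%N.
  by apply: leq_trans le2; rewrite mulnA [(#|H1| * 2)%N]mulnC leq_mul2r HL orbT.
rewrite leq_pmul2l // -PU cardsD (setIidPr (forward_part_sub i p)).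
by have := subset_leq_card (forward_part_sub i p); lia.
Qed.

Lemma contains_tprod (psi : H2 -> T) : embedding psi ->
  (forall h, psi h \in nth set0 (long_rep v (family_mseq forward_part)) (f2 h).-1) ->
  contains T (tprod inj1 inj2 orth).
Proof.
move=> psi_emb psiP.
(* The order of labels is the lexicographic order of (block, part). Labels start at 1, and
   positivity keeps the predecessor strictly monotone. *)
have lex (a b : nat) (r := reshape_index long_shape) (c := reshape_offset long_shape) :
    (0 < a)%N -> (a < b)%N ->
    (r a.-1 < r b.-1)%N \/ r a.-1 = r b.-1 /\ (c a.-1 < c b.-1)%N.
  move=> a0 ab; have : ~~ (b.-1 <= a.-1)%N by lia.
  rewrite (reshape_leq long_shape) -/(r _) -/(r _) -/(c _) -/(c _).
  rewrite negb_or negb_and -leqNgt leq_eqVlt -ltnNge.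
  case/andP => /orP[/eqP rr|->]; last by left.
  by rewrite rr eqxx => /= cc; right.
have cross x y : edge (phi x) (psi y) = (f1 x < f2 y)%N.
  have [i [ri pi xi]] := mem_long_rep (phiP x).
  have [j [rj pj yj]] := mem_long_rep (psiP y).
  have yP := subsetP (forward_part_sub _ _) _ yj.
  have := yj; rewrite inE => /andP[_ /forallP/(_ x)/forallP/(_ i)/implyP].
  move=> /(_ _)/implyP/= fwd.
  have {}fwd : i != j -> ~~ against i j (phi x) (psi y).
    by apply: fwd; apply/bigcupP; exists (Ordinal pi).
  have [xy|yx] := ltnP (f1 x) (f2 y).
    have [ij|[ij pp]] := lex _ _ (f1_gt0 x) xy.
      rewrite ri rj in ij; move: fwd; rewrite -val_eqE neq_ltn ij /against ij negbK.
      exact.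
    have {}ij : i = j by apply: val_inj; rewrite /= -ri -rj.
    by move: yP pj; rewrite -ij => yP pj; apply: (family_complete fam _ xi yP); rewrite pp.
  have {}yx : (f2 y < f1 x)%N.
    by rewrite ltn_neqAle yx andbT; apply/eqP => /esym/orth.
  apply: edge_asym; have [ij|[ij pp]] := lex _ _ (f2_gt0 y) yx.
    rewrite ri rj in ij; move: fwd; rewrite -val_eqE neq_ltn ij orbT /against.
    by rewrite ltnNge ltnW //= negbK => /(_ isT).
  have {}ij : i = j by apply: val_inj; rewrite /= -ri -rj.
  by move: yP pj; rewrite -ij => yP pj; apply: (family_complete fam _ yP xi); rewrite pp.
(* A common vertex lies in a single block, with the label of y below that of x by [cross];
   completeness between the two parts would then give a loop. *)
have neq x y : phi x <> psi y.
  move=> eq; have := cross x y; rewrite eq edge_irr => /esym/negbT.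
  rewrite -leqNgt leq_eqVlt => /orP[/eqP/esym/orth//|yx].
  have [i [ri pi xi]] := mem_long_rep (phiP x).
  have [j [rj pj yj]] := mem_long_rep (psiP y).
  have {}yj := subsetP (forward_part_sub _ _) _ yj.
  have [ij|ij] := eqVneq i j; last first.
    have := family_disjoint fam (reshape_offset long_shape (f1 x).-1)
      (reshape_offset long_shape (f2 y).-1) ij.
    by move=> /pred0P/(_ (phi x)); rewrite /= xi eq yj.
  have [|[_ pp]] := lex _ _ (f2_gt0 y) yx; first by rewrite ri rj ij ltnn.
  rewrite -ij in yj; have := family_complete fam _ yj xi.
  by rewrite eq edge_irr pp pi => /(_ isT).
exists (fun u => match u with inl x => phi x | inr y => psi y end).
have [phi_inj phiE] := phi_emb; have [psi_inj psiE] := psi_emb.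
split.
  case=> [x|x] [y|y] //=; first by move/phi_inj->.
  - by move/neq.
  - by move/esym/neq.
  - by move/psi_inj->.
have same (K : tournament) (f : K -> nat) x y : injective f ->
    (if (f x < f y)%N then ~~ backward f y x else backward f x y) = edge x y.
  move=> injf; rewrite /backward; case: ltngtP => [xy|xy|/injf->].
  - by rewrite andbT -edge_tour //; apply: contraTneq xy => ->; rewrite ltnn.
  - by rewrite andbT.
  - by rewrite edge_irr.
case=> [x|x] [y|y]; rewrite /= /prod_edge /=.
- by rewrite phiE same.
- by rewrite cross; case: ifP.
- rewrite edge_tour; last by apply/eqP => /esym/neq.
  by rewrite cross -leqNgt leq_eqVlt; case: eqP => [/esym/orth|_] //=; case: ifP.
- by rewrite psiE same.
Qed.
End Product.
End MSequences.

(** * Minimal counterexamples *)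

Section Critical.
Local Open Scope ring_scope.
Variable R : realType.
Implicit Types (eps c : R).

(** The first clause says that T violates the bound, the second that no proper subtournament
    does. *)
Definition critical eps (T : tournament) : Prop :=
  (forall S : {set T}, transitive_set S -> #|S|%:R < #|T|%:R `^ eps) /\
  (forall X : {set T}, X \proper setT -> exists S : {set T},
     [/\ S \subset X, transitive_set S & #|X|%:R `^ eps <= #|S|%:R]).

Lemma EH_by_critical (I : finType) (H : I -> tournament) eps : 0 < eps ->
  (forall T, (forall i, ~ contains T (H i)) -> ~ critical eps T) ->
  EH_property R H.
Proof.
move=> eps0 nocrit; exists eps => // T.
have [n] := ubnP #|T|; elim: n T => // n IH T ltn free.
apply: contrapT => noS; apply: (nocrit T free); split.
  move=> S trS; rewrite ltNge; apply/negP => le; apply: noS; exists S.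
  by split.
move=> X XT; have [||S [trS leS]] := IH (induced T X).
- rewrite card_induced; apply: leq_trans (_ : #|T| <= n)%N; last by [].
  by rewrite -(cardsT T) proper_card.
- by move=> i /induced_contains/free.
have [S' S'X [trS' eqS]] := induced_transitive trS.
by exists S'; split; rewrite // eqS -(card_induced X).
Qed.

(** This calibration makes shrinking a set to a share c cost only a factor 1 - c in the guaranteed
    transitive size. *)
Lemma exists_exponent c : 0 < c -> c < 1 -> exists2 eps, 0 < eps & c `^ eps = 1 - c.
Proof.
move=> c0 c1; have lnc : ln c < 0 by rewrite ln_lt0 // c0.
exists (ln (1 - c) / ln c).
  rewrite ltr_ndivlMr // mul0r ln_lt0 //; lra.
rewrite /powR gt_eqF // divfK ?lt_eqF // lnK // posrE; lra.
Qed.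

Variables (T : tournament) (eps c : R).
Hypotheses (eps0 : 0 < eps) (c0 : 0 < c) (c_half : c <= 2^-1).
Hypotheses (powc : c `^ eps = 1 - c) (crit : critical eps T).

Lemma tr_lt_critical : (tr T)%:R < #|T|%:R `^ eps.
Proof. by have [S /crit.1 + <-] := tr_witness T. Qed.

Lemma powR_critical (X : nat) : c * #|T|%:R <= X%:R ->
  (1 - c) * #|T|%:R `^ eps <= X%:R `^ eps.
Proof.
move=> cX; rewrite -powc -powRM ?ler0n ?(ltW c0) //.
have h0 : 0 <= c * #|T|%:R by rewrite mulr_ge0 ?ler0n ?ltW.
by apply: ge0_ler_powR; rewrite ?nnegrE ?ler0n ?(ltW eps0).
Qed.

(** Otherwise |T|^eps <= 1/(1 - c) <= 2, so tr(T) <= 1 and |T| <= 1, and both remaining sizes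
    contradict tr(T) < |T|^eps. *)
Lemma critical_large_card : 1 < c * #|T|%:R.
Proof.
rewrite ltNge; apply/negP => /(powR_critical (X := 1)); rewrite powR1 => le.
have trlt := tr_lt_critical.
have {le} tr1 : (tr T < 2)%N.
  rewrite -(ltr_nat R); have := powR_ge0 (#|T|%:R : R) eps; move: le trlt.
  by set p := _ `^ _; set t := (tr T)%:R; move: c_half; nra.
have : (#|T| < 2)%N by rewrite ltnNge; apply: contraL tr1; rewrite -leqNgt => /(tr_log (k := 1)).
case E: #|T| => [|[|n]] // _; move: trlt; rewrite E.
  by rewrite powR0 ?gt_eqF // ltNge ler0n.
rewrite powR1 ltNge ler1n => /negP[]; by apply: tr_gt0; rewrite E.
Qed.

Lemma critical_subset (X : {set T}) : c * #|T|%:R <= #|X|%:R ->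
  X \proper setT -> exists S : {set T},
  [/\ S \subset X, transitive_set S & (1 - c) * #|T|%:R `^ eps <= #|S|%:R].
Proof.
move=> cX /crit.2[S [SX trS le]]; exists S; split=> //; apply: le_trans le.
exact: powR_critical.
Qed.

Lemma critical_large_transitive N (X : {set T}) : c <= N%:R^-1 ->
  (#|T| <= N * #|X|)%N ->
  exists Y : {set T}, [/\ Y \subset X, transitive_set Y & (tr T <= 2 * #|Y|)%N].
Proof.
move=> cN leX; have [XT|] := boolP (X \proper setT); last first.
  rewrite properT negbK => /eqP->; have [Y trY eqY] := tr_witness T.
  by exists Y; rewrite subsetT eqY leq_pmull.
have N0 : (0 < N)%N.
  by move: cN; case: N {leX} => // ; rewrite invr0 leNgt c0.
have [|S [SX trS le]] := @critical_subset X _ XT.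
  apply: le_trans (_ : N%:R^-1 * #|T|%:R <= _); first by rewrite ler_wpM2r ?ler0n.
  by rewrite ler_pdivrMl ?ltr0n // -natrM ler_nat.
exists S; split=> //; rewrite -(ler_nat R) natrM.
have := powR_ge0 (#|T|%:R : R) eps; have := tr_lt_critical; move: le.
by set p := _ `^ _; set t := (tr T)%:R; move: c_half; nra.
Qed.

(** A contains a transitive set of size at least (1 - c)|T|^eps. Together with a similar one in B it
    reaches |T|^eps, as c <= 1/2. Together with a transitive B it has more than (1 - c)tr(T) + c
    tr(T) = tr(T) vertices. Both unions are transitive by completeness. *)
Lemma critical_no_strong_pair m (chi : mseq T m) c' (A B : {set T}) : c <= c' ->
  ~ strong_pair chi c' A B.
Proof.
move=> cc [_ dis cA cB dens].
have {dens} [A0 B0 AB] : [/\ (0 < #|A|)%N, (0 < #|B|)%N &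
    complete_to A B \/ complete_to B A].
  case: dens => dens; have [? ?] := card_gt0_density dens; split=> //.
    by left; apply: density1_complete dens.
  by right; apply: density1_complete dens.
have cle n : c * n%:R <= c' * n%:R :> R by rewrite ler_wpM2r ?ler0n.
have proper (X Y : {set T}) : [disjoint X & Y] -> (0 < #|Y|)%N -> X \proper setT.
  move=> XY /card_gt0P[y yY]; rewrite properT; apply: contraTneq XY => ->.
  by apply/pred0Pn; exists y; rewrite /= inE.
have trU (X Y : {set T}) : [disjoint X & Y] -> complete_to X Y \/ complete_to Y X ->
    transitive_set X -> transitive_set Y -> (#|X| + #|Y|)%:R < #|T|%:R `^ eps :> R
    /\ (#|X| + #|Y| <= tr T)%N.
  move=> XY comp tX tY; have tXY : transitive_set (X :|: Y).
    by case: comp => comp; [|rewrite setUC]; apply: transitive_setU.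
  have eXY : (#|X :|: Y| = #|X| + #|Y|)%N by rewrite cardsU disjoint_setI0 // cards0 subn0.
  by rewrite -eXY; split; [apply: crit.1|apply: leq_tr].
have comp_sub (X X' Y Y' : {set T}) : X' \subset X -> Y' \subset Y ->
    complete_to X Y -> complete_to X' Y'.
  move=> sX sY comp x y /(subsetP sX) xX /(subsetP sY); exact: comp.
have [|SA [SAA trA leA]] := critical_subset (le_trans (cle _) cA).
  by apply: proper dis _.
have disA (Y : {set T}) : Y \subset B -> [disjoint SA & Y].
  by move=> YB; apply: disjointWl SAA (disjointWr YB dis).
have compA (Y : {set T}) : Y \subset B -> complete_to SA Y \/ complete_to Y SA.
  by move=> YB; case: AB => comp; [left|right]; apply: comp_sub comp.
case: cB => [cB|[tB cB]].
  have [|SB [SBB trB leB]] := critical_subset (le_trans (cle _) cB).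
    by apply: (@proper _ A); rewrite // disjoint_sym.
  have [lt _] := trU _ _ (disA _ SBB) (compA _ SBB) trA trB.
  have := powR_ge0 (#|T|%:R : R) eps; move: lt leA leB; rewrite natrD.
  by set p := _ `^ _; move: c_half; nra.
have [_] := trU _ _ (disA _ (subxx _)) (compA _ (subxx _)) trA tB.
rewrite -(ler_nat R) natrD => le; have := le_trans (cle _) cB.
have := tr_lt_critical; have c1 : 0 < 1 - c by move: c_half; lra.
by move=> lt leB; have := lt; rewrite -(ltr_pM2l c1); lra.
Qed.
End Critical.

(** * Choice of constants and the product of two nonempty families *)

Lemma positive_lower_bound (R : realType) (f : nat -> R) M :
  (forall N, 0 < f N)%R -> exists2 c : R, (0 < c)%R & forall N, N <= M -> (c <= f N)%R.
Proof.
move=> f0; elim: M => [|M [c c0 cf]].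
  by exists (f 0) => // N; rewrite leqn0 => /eqP->.
exists (Num.min c (f M.+1)); first by rewrite lt_min c0 f0.
move=> N; rewrite leq_eqVlt ltnS => /predU1P[->|/cf cN]; first by rewrite ge_min lexx orbT.
by rewrite ge_min cN.
Qed.

Lemma strong_EH_inv (R : realType) (I : finType) (H : I -> tournament)
    (F : forall i, H i -> nat) (m : nat) (v : m.-tuple bool)
    (eta : (zeta v m).-tuple nat) (C : nat) : strong_EH R F eta -> (0 < C)%N ->
  exists L c2, (0 < c2 :> R)%R /\
    forall (T : tournament) (lambda : R) (chi : mseq T m),
      (0 < #|T|)%N -> (0 <= lambda <= L.+1%:R^-1)%R ->
      is_mseq eta (C%:R^-1 : R)%R lambda chi ->
      (exists (i : I) (phi : H i -> T), embedding phi /\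
         forall h, phi h \in nth set0 (long_rep v chi) (F i h).-1) \/
      (exists A B : {set T}, strong_pair chi c2 A B).
Proof.
move=> strong C0; have [|l [c2 [l0 c20 strongC]]] := strong (C%:R^-1 : R)%R.
  by rewrite invr_gt0 ltr0n.
exists (Num.Def.trunc l^-1), c2; split=> // T lambda chi T0 /andP[h0 hl].
apply: strongC; rewrite // h0 (le_trans hl) // invf_ple ?posrE ?ltr0n //.
exact/ltW/truncnS_gt.
Qed.

Lemma EH_tprod (R : realType) (m : nat) (v : m.-tuple bool)
    (eta : (zeta v m).-tuple nat)
    (eta_gt0 : forall n, n \in (eta : seq nat) -> (0 < n)%N)
    (I1 I2 : finType) (H1 : I1 -> tournament) (H2 : I2 -> tournament)
    (F : forall i, H1 i -> nat) (G : forall j, H2 j -> nat)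
    (F_gt0 : forall i x, (0 < F i x)%N) (G_gt0 : forall j y, (0 < G j y)%N)
    (F_inj : forall i, injective (F i)) (G_inj : forall j, injective (G j))
    (FG_orth : forall i j, orthogonal_labels (F i) (G j))
    (H1_strong : strong_EH R F eta) (H2_strong : strong_EH R G eta)
    (i0 : I1) (j0 : I2) :
  EH_property R (fun ij : I1 * I2 =>
    tprod (F_inj ij.1) (G_inj ij.2) (FG_orth ij.1 ij.2)).
Proof.
pose q := parts_count eta.
pose Q := (\max_i q i).+1.
have q_gt0 i : (0 < q i)%N by apply: parts_count_gt0.
have qQ i : (0 < q i <= Q)%N by rewrite q_gt0 (leq_trans (leq_bigmax i)).
have q1 i : ~~ tnth v i -> q i = 1%N by rewrite /q /parts_count => /negbTE->.
(* This is the size constant of [exists_regular_family]; [N.-1.+1] equals N for positive N and keeps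
   the value positive at 0, since the choices below range over all N. *)
pose C N := (2 * Q * (4 * N.-1.+1))%N.
have C0 N : (0 < C N)%N by rewrite !muln_gt0.
have /choice[L1 /choice[c1 strong1]] := fun N => strong_EH_inv H1_strong (C0 N).
(* The second property is used on the forward parts, which may be half as large. *)
have C20 N : (0 < 2 * C N)%N by rewrite muln_gt0 C0.
have /choice[L2 /choice[c2 strong2]] := fun N => strong_EH_inv H2_strong (C20 N).
pose L N := (L1 N + L2 N + 2 * (\sum_i #|H1 i|) + 2)%N.
(* The density that [exists_regular_family] needs for regularity [2 * L N], which drops to [L N] on
   the forward parts. The partial sums [Lam] make it monotone. *)
pose Lam0 N := (2 * (2 * L N * (2 * Q)) * (2 * m) * (2 * m) ^ m)%N.
pose Lam N := (\sum_(i < N.+1) Lam0 i)%N.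
have Lam_mono : {homo Lam : a b / (a <= b)%N}.
  move=> a b ab; rewrite /Lam -!(big_mkord predT Lam0).
  by rewrite [leqRHS](big_cat_nat _ (n := a.+1)) //= leq_addr.
have Lam0_le N : (Lam0 N <= Lam N)%N by rewrite /Lam big_ord_recr /= leq_addl.
pose H := tprod (F_inj i0) (G_inj j0) (FG_orth i0 j0).
have [M MP] := exists_dense_sequence H m Lam_mono.
have [c' c'0 c'le] := positive_lower_bound (f := fun N => Num.min (c1 N) (c2 N)) M
  (fun N => ltac:(by rewrite lt_min (strong1 N).1 (strong2 N).1)).
(* As c <= 1/K and c|T| > 1, the summands give in turn c <= 1/2, |T| >= M, c <= 1/(2N) for all
   positive N <= M, and tr(T) >= 4Q. *)
pose K := (2 + M + 2 * M.+1 + 2 ^ (4 * Q))%N.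
pose c := (Num.min c' K%:R^-1)%R.
have c0 : (0 < c)%R by rewrite lt_min c'0 invr_gt0 ltr0n.
have cK k : (0 < k <= K)%N -> (c <= k%:R^-1)%R.
  move=> /andP[k0 kK]; rewrite ge_min; apply/orP; right.
  by rewrite lef_pV2 ?posrE ?ltr0n // ler_nat.
have c_half : (c <= 2^-1)%R by apply: cK; rewrite /K; lia.
have c_lt1 : (c < 1)%R by apply: le_lt_trans c_half _; rewrite invf_lt1 ?ltr1n.
have [eps eps0 powc] := exists_exponent c0 c_lt1.
apply: (EH_by_critical eps0) => T free crit.
have largeT := critical_large_card eps0 c0 c_half powc crit.
have KT : (K <= #|T|)%N.
  have K0 : (0 < K%:R :> R)%R by rewrite ltr0n.
  have : (1 <= K%:R^-1 * #|T|%:R :> R)%R.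
    apply: le_trans (ltW largeT) _; rewrite ler_wpM2r ?ler0n //.
    by rewrite cK // leqnn.
  by rewrite ler_pdivlMl // mulr1 ler_nat.
have T0 : (0 < #|T|)%N by apply: leq_trans KT.
have trQ : (4 * Q <= tr T)%N.
  apply/ltnW/tr_log; apply: leq_trans KT; exact: leq_addl.
have freeH : ~ contains T H by apply: (free (i0, j0)).
have MT : (M <= #|[set: T]|)%N by rewrite cardsT; apply: leq_trans KT; rewrite /K; lia.
have [N [A [/andP[N0 NM] AT Adense]]] := MP T setT freeH MT.
have nopair N' (chi : mseq T m) c3 : (N' <= M)%N -> c3 = c1 N' \/ c3 = c2 N' ->
    ~ exists A B : {set T}, strong_pair chi c3 A B.
  move=> N'M c3E [X [Y]]; apply: (critical_no_strong_pair eps0 c0 c_half powc crit).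
  have := c'le N' N'M; rewrite le_min => /andP[h1 h2].
  by case: c3E => ->; rewrite ge_min ?h1 ?h2.
have NSz (i : 'I_m) : (#|T| <= N * #|A i|)%N.
  by rewrite -(cardsT T); apply: (AT i (ltn_ord i)).2.
have [||||P [fam reg]] := @exists_regular_family T m (tnth v) q (2 * L N) N Q
    (fun i => A i) N0 qQ q1 trQ.
- move=> X; apply: (critical_large_transitive eps0 c0 c_half powc crit).
  by apply: cK; rewrite /K; lia.
- exact: NSz.
- have lt (i j : 'I_m) : (i < j)%N -> [disjoint A i & A j].
    by move=> ij; apply: (Adense i j _).1; rewrite ij ltn_ord.
  move=> i j; rewrite -val_eqE neq_ltn => /orP[/lt//|/lt].
  by rewrite disjoint_sym.
- apply: all_dense_lt => i j ij.
  have [|_] := Adense i j; first by rewrite ij ltn_ord.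
  by apply: leq_trans; rewrite leq_mul2r Lam0_le orbT.
have CN : (2 * Q * (4 * N))%N = C N by rewrite /C prednK.
rewrite CN in fam; have L_gt1 : (1 < L N)%N by rewrite /L; lia.
have lam_le a b : (b.+1 <= a)%N -> (0 <= (a%:R^-1 : R) <= b.+1%:R^-1)%R.
  by move=> ba; rewrite invr_ge0 ler0n /= lef_pV2 ?posrE ?ltr0n ?ler_nat //; lia.
have [||[i [phi [phi_emb phiP]]]|] := (strong1 N).2 T (2 * L N)%:R^-1%R (family_mseq eta P) T0.
- by apply: lam_le; rewrite /L; lia.
- apply: (is_mseq_family _ _ _ _ _ fam) => //; first by lia.
  by move=> i j; apply: (regular_blocks fam reg).
2: by apply: nopair NM _; left.
pose P' := forward_part eta P phi.
have subP' : forall i p, P' i p \subset P i p by apply: forward_part_sub.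
have halfP' a p : (p < q a)%N -> (#|P a p| <= 2 * #|P' a p|)%N.
  apply: (forward_part_large fam phiP _ reg).
  have : (#|H1 i| <= \sum_i #|H1 i|)%N by rewrite (bigD1 i) //= leq_addr.
  by rewrite /L; lia.
have fam' := family_shrink subP' halfP' fam.
have reg' := regular_shrink subP' halfP' reg.
have [||[j [psi [psi_emb psiP]]]|] := (strong2 N).2 T (L N)%:R^-1%R (family_mseq eta P') T0.
- by apply: lam_le; rewrite /L; lia.
- apply: (is_mseq_family _ _ _ _ _ fam') => //.
  by move=> a b; apply: (regular_blocks fam' reg').
2: by apply: nopair NM _; right.
apply: (free (i, j)).
exact: (contains_tprod _ _ _ (F_gt0 i) (G_gt0 j) fam phi_emb phiP psi_emb psiP).
Qed.

(** * Strong EH-families are nonempty *)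

Lemma card_fiber (V W : finType) (phi : V -> W) (a : W) :
  (forall b c, exists2 t : V -> V, injective t &
     forall u, phi u = b -> phi (t u) = c) ->
  #|W| * #|[set u | phi u == a]| = #|V|.
Proof.
move=> shift.
have le b c : #|[set u | phi u == b]| <= #|[set u | phi u == c]|.
  have [t tinj tP] := shift b c; rewrite -(card_imset _ tinj).
  apply/subset_leq_card/subsetP => _ /imsetP[u + ->].
  by rewrite !inE => /eqP/tP->.
rewrite -sum_nat_const -[RHS]sum1_card (partition_big phi predT) //=.
apply: eq_bigr => b _; rewrite sum1dep_card.
by apply/eqP; rewrite eqn_leq !le.
Qed.

(* Chebyshev's inequality: for uniform u, the events P u w have probability 1/p *)
(* and are pairwise at most as likely as if they were independent. *)
Lemma second_moment (U W : finType) (P : U -> W -> bool) (p : nat)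
    (A : {set U}) (B : {set W}) :
  (forall w, p * #|[set u | P u w]| = #|U|) ->
  (forall w w', w != w' -> p ^ 2 * #|[set u | P u w && P u w']| <= #|U|) ->
  {in A & B, forall u w, ~~ P u w} -> #|A| * #|B| <= p * #|U|.
Proof.
move=> single double avoid.
have cardE (Q : pred U) : \sum_u Q u = #|[set u | Q u]|.
  by rewrite -sum1dep_card [RHS]big_mkcond.
have [B0|B0] := posnP #|B|; first by rewrite B0 muln0.
pose N u := \sum_(w in B) P u w.
have sumN : p * \sum_u N u = #|B| * #|U|.
  rewrite exchange_big big_distrr -sum_nat_const; apply: eq_bigr => w _.
  by rewrite -(single w) cardE.
have sumN2 : p ^ 2 * \sum_u N u ^ 2 <= p * #|B| * #|U| + #|B| ^ 2 * #|U|.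
  have -> : \sum_u N u ^ 2 =
      \sum_(w in B) \sum_(w' in B) #|[set u | P u w && P u w']|.
    transitivity (\sum_u \sum_(w in B) \sum_(w' in B) (P u w && P u w' : nat)).
      apply: eq_bigr => u _; rewrite -mulnn /N big_distrl; apply: eq_bigr => w _.
      by rewrite big_distrr; apply: eq_bigr => w' _; apply: mulnb.
    rewrite exchange_big; apply: eq_bigr => w _; rewrite exchange_big.
    by apply: eq_bigr => w' _; apply: cardE.
  have -> : p * #|B| * #|U| + #|B| ^ 2 * #|U| =
      \sum_(w in B) (p * #|U| + #|B| * #|U|).
    by rewrite sum_nat_const; ring.
  rewrite big_distrr; apply: leq_sum => w wB; rewrite big_distrr (bigD1 w) //=.
  apply: leq_add.
    rewrite -mulnn -mulnA leq_mul2l; apply/orP; right; rewrite -(single w).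
    rewrite leq_mul2l; apply/orP; right; apply/subset_leq_card/subsetP => u.
    by rewrite !inE andbb.
  apply: leq_trans (_ : \sum_(w' in B | w' != w) #|U| <= _).
    by apply: leq_sum => w' /andP[_ ww']; apply: double; rewrite eq_sym.
  rewrite -sum_nat_const [leqRHS](bigD1 w) //=; exact: leq_addl.
have NA u : u \in A -> N u = 0.
  by move=> uA; rewrite /N big1 // => w wB; apply/eqP; rewrite eqb0 avoid.
(* Summand by summand this is 2(p N)|B| <= (p N)^2 + |B|^2; on A, where N vanishes, the whole |B|^2
   is gained. *)
have amgm : 2 * p * #|B| * \sum_u N u + #|A| * #|B| ^ 2 <=
    p ^ 2 * \sum_u N u ^ 2 + #|U| * #|B| ^ 2.
  have -> : #|A| * #|B| ^ 2 = \sum_u (u \in A) * #|B| ^ 2.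
    by rewrite -big_distrl /= (cardE (mem A)) cardsE.
  rewrite -(sum_nat_const predT) !big_distrr -!big_split /=.
  apply: leq_sum => u _; case: (boolP (u \in A)) => [/NA->|_].
    by rewrite muln0 mul1n leq_addl.
  rewrite mul0n addn0 -expnMn (_ : 2 * p * #|B| * N u = 2 * (p * N u * #|B|)).
    exact: nat_Cauchy.
  by ring.
have E : 2 * p * #|B| * \sum_u N u = 2 * (#|B| ^ 2 * #|U|).
  transitivity (2 * #|B| * (p * \sum_u N u)); first by ring.
  by rewrite sumN; ring.
rewrite -(leq_pmul2r B0) -mulnA mulnn.
rewrite (_ : p * #|U| * #|B| = p * #|B| * #|U|); last by ring.
move: amgm sumN2; rewrite {}E [#|U| * _]mulnC; lia.
Qed.

(** * A blow-up of tournaments defined by a skew form *)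

Section SkewForm.
Local Open Scope ring_scope.
Variables (K : finFieldType) (D : nat).
Hypothesis K_odd : 1 != - 1 :> K.

Notation V := ('rV[K]_D * 'rV[K]_D * K)%type.

Definition dot (a b : 'rV[K]_D) : K := (a *m b^T) 0 0.

Lemma dotC a b : dot a b = dot b a.
Proof. by rewrite /dot -[in RHS](trmxK b) -trmx_mul [RHS]mxE. Qed.

Lemma dotDl a b c : dot (a + b) c = dot a c + dot b c.
Proof. by rewrite /dot mulmxDl mxE. Qed.

Lemma dotZl x a b : dot (x *: a) b = x * dot a b.
Proof. by rewrite /dot -scalemxAl mxE. Qed.

Lemma dot_delta i b : dot (delta_mx 0 i) b = b 0 i.
Proof. by rewrite /dot -rowE !mxE. Qed.

(** The standard symplectic form plus the difference of an extra coordinate. Translating that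
    coordinate shifts all values at once, so each value is equidistributed in u. *)
Definition skew (u w : V) : K :=
  dot u.1.1 w.1.2 - dot w.1.1 u.1.2 + (u.2 - w.2).

Lemma skewN u w : skew w u = - skew u w.
Proof. by rewrite /skew; ring. Qed.

Definition shift (x : K) (d : V) (u : V) : V :=
  (u.1.1 + x *: d.1.1, u.1.2 + x *: d.1.2, u.2 + x * d.2).

Lemma shift_inj x d : injective (shift x d).
Proof.
move=> [[a b] s] [[a' b'] s'] [/addIr-> /addIr->].
by move=> /addIr->.
Qed.

Lemma skew_shift x d u w : skew (shift x d u) w =
  skew u w + x * (dot d.1.1 w.1.2 - dot d.1.2 w.1.1 + d.2).
Proof.
rewrite /skew /= [dot w.1.1 (_ + _)]dotC !dotDl !dotZl [dot w.1.1 _]dotC; ring.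
Qed.

Lemma card_skew_eq w x : (#|K| * #|[set u | skew u w == x]|)%N = #|{: V}|.
Proof.
apply: card_fiber => b c; exists (shift (c - b) (0, 0, 1)); first exact: shift_inj.
move=> u ub; rewrite skew_shift /= ub /dot !mul0mx !mxE; ring.
Qed.

Lemma exists_separating_direction (w w' : V) : w.1 != w'.1 ->
  exists d : V, dot d.1.1 w.1.2 - dot d.1.2 w.1.1 + d.2 !=
                dot d.1.1 w'.1.2 - dot d.1.2 w'.1.1 + d.2.
Proof.
have dot0 b : dot 0 b = 0 by rewrite /dot mul0mx mxE.
case: w w' => [[a b] s] [[a' b'] s'] /= ne.
have [eb|] := eqVneq b b'.
  have /rV0Pn[i] : a - a' != 0.
    by rewrite subr_eq0; apply: contra ne => /eqP->; rewrite eb.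
  rewrite !mxE subr_eq0 => ai; exists (0, delta_mx 0 i, 0) => /=.
  by rewrite !dot0 !dot_delta !addr0 !sub0r eqr_opp.
rewrite -subr_eq0 => /rV0Pn[i]; rewrite !mxE subr_eq0 => bi.
by exists (delta_mx 0 i, 0, 0); rewrite /= !dot0 !dot_delta !addr0 !subr0.
Qed.

(** If w and w' differ only in the extra coordinate, the two values are never equal. Otherwise a
    separating direction and the extra coordinate together translate the pair of values arbitrarily,
    so the pair is equidistributed. *)
Lemma card_skew_eq2 (w w' : V) x : w != w' ->
  (#|K| ^ 2 * #|[set u | (skew u w == x) && (skew u w' == x)]| <= #|{: V}|)%N.
Proof.
move=> ne; have [e1|ne1] := eqVneq w.1 w'.1.
  rewrite (_ : finset _ = set0) ?cards0 ?muln0 //; apply/setP => u.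
  rewrite !inE; apply/negP => /andP[/eqP <-].
  rewrite /skew e1 eq_sym (inj_eq (addrI _)) (inj_eq (addrI _)) eqr_opp => /eqP e2.
  by case/eqP: ne; case: w w' e1 e2 => [? ?] [? ?] /= -> ->.
have [d dP] := exists_separating_direction ne1.
set e := dot _ _ - _ + _ in dP; set e' := _ + _ in dP.
have ee : e - e' != 0 by rewrite subr_eq0.
rewrite -mulnn -card_prod.
rewrite (_ : finset _ = [set u | (skew u w, skew u w') == (x, x)]).
  rewrite card_fiber // => -[b b'] [c c'].
  pose y := ((c - b) - (c' - b')) / (e - e').
  pose z := (c - b) - y * e.
  exists (shift y d \o shift z (0, 0, 1)).
    by apply: inj_comp; apply: shift_inj.
  move=> u [ub ub']; rewrite /= !skew_shift /= -/e -/e' ub ub' /dot !mul0mx !mxE.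
  by congr pair; rewrite /z /y; field.
by apply/setP => u; rewrite !inE.
Qed.

Lemma skew_hit (A B : {set V}) x : (#|K| * #|{: V}| < #|A| * #|B|)%N ->
  exists u w, [/\ u \in A, w \in B & skew u w = x].
Proof.
move=> lt; apply: contrapT => nohit; move: lt; rewrite ltnNge => /negP[].
apply: (@second_moment _ _ (fun u w => skew u w == x)).
- by move=> w; apply: card_skew_eq.
- by move=> w w'; apply: card_skew_eq2.
by move=> u w uA wB; apply/eqP => e; apply: nohit; exists u, w.
Qed.

(** The value 1 forces a forward edge and -1 a backward one, so pairs large enough to realise both
    values are not complete; the enumeration decides the rest. *)
Definition block_edge : rel V := fun x y =>
  (x != y) && ((skew x y == 1) || (skew x y != -1) && (enum_rank x < enum_rank y)%N).

Lemma block_edge_irr : irreflexive block_edge.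
Proof. by move=> x; rewrite /block_edge eqxx. Qed.

Lemma block_edge_tour x y : x != y -> block_edge x y = ~~ block_edge y x.
Proof.
move=> xy; rewrite /block_edge [y == x]eq_sym xy /= (skewN x y).
rewrite eqr_opp eqr_oppLR.
have rank : (enum_rank x < enum_rank y)%N = ~~ (enum_rank y < enum_rank x)%N.
  by rewrite -leqNgt ltn_neqAle val_eqE (inj_eq enum_rank_inj) xy.
have [->|n1] := eqVneq (skew x y) 1; first by rewrite (negbTE K_odd).
by have [_|nN1] := eqVneq (skew x y) (-1).
Qed.

Definition block_tour := Tournament block_edge_irr block_edge_tour.

Variables (m : nat) (kappa : K).

Definition blowup_edge : rel ('I_m * V) := fun u w =>
  if (u.1 < w.1)%N then skew u.2 w.2 != kappa
  else if (w.1 < u.1)%N then skew w.2 u.2 == kappa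
  else block_edge u.2 w.2.

Lemma blowup_edge_irr : irreflexive blowup_edge.
Proof. by move=> u; rewrite /blowup_edge ltnn block_edge_irr. Qed.

Lemma blowup_edge_tour u w : u != w -> blowup_edge u w = ~~ blowup_edge w u.
Proof.
move=> uw; rewrite /blowup_edge; case: ltngtP => // [|/val_inj e1].
  by rewrite negbK.
apply: block_edge_tour; apply: contraNneq uw.
by case: u w e1 => [? ?] [? ?] /= -> ->.
Qed.

Definition blowup := Tournament blowup_edge_irr blowup_edge_tour.

(** In each pair of fibres the form must miss a value: [kappa] or [1 - kappa] in different slices,
    -1 in the same slice. By [skew_hit] the product of the fibre sizes is then at most |K||V|;
    summing over the pairs of slices gives the bound. *)
Lemma complete_blowup (A B : {set blowup}) : complete_to A B ->
  (#|A| * #|B| <= m * #|K| * #|blowup|)%N.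
Proof.
move=> AB; pose fib (X : {set blowup}) i := [set x : V | (i, x) \in X].
have cfib (X : {set blowup}) : #|X| = (\sum_i #|fib X i|)%N.
  rewrite -sum1_card (eq_bigr (fun i => \sum_(x | (i, x) \in X) 1)%N).
    by rewrite pair_big_dep; apply: eq_bigl => -[].
  by move=> i _; rewrite sum1dep_card.
have le i j : (#|fib A i| * #|fib B j| <= #|K| * #|{: V}|)%N.
  rewrite leqNgt; apply/negP => lt.
  have nohit x : exists u w, [/\ blowup_edge (i, u) (j, w) & skew u w = x].
    have [u [w [uA wB e]]] := skew_hit x lt; exists u, w; split=> //.
    by apply: AB; [move: uA|move: wB]; rewrite inE.
  have [ij|ji|ij] := ltngtP i j.
  - by have [u [w []]] := nohit kappa; rewrite /blowup_edge /= ij => /eqP.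
  - have [u [w []]] := nohit (1 - kappa).
    rewrite /blowup_edge /= ltnNge ltnW //= ji skewN => /eqP <-.
    by rewrite opprK -[LHS]add0r => /addIr/esym/eqP; rewrite oner_eq0.
  have [u [w []]] := nohit (-1).
  rewrite /blowup_edge /= ij ltnn /block_edge => + e; rewrite e eqxx /=.
  by rewrite orbF [_ == 1]eq_sym (negbTE K_odd) andbF.
rewrite (cfib A) (cfib B) big_distrl /= card_prod card_ord.
apply: leq_trans (_ : \sum_(i < m) \sum_(j < m) #|K| * #|{: V}| <= _)%N.
  by apply: leq_sum => i _; rewrite big_distrr; apply: leq_sum => j _; apply: le.
by rewrite !sum_nat_const !card_ord -!mulnA leq_mul2l [leqRHS]mulnCA leqnn orbT.
Qed.

Definition slice (i : 'I_m) (X : {set V}) : {set blowup} := [set (i, x) | x in X].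

Lemma card_slice i X : #|slice i X| = #|X|.
Proof. by rewrite card_imset // => x y []. Qed.

Lemma transitive_slice i (X : {set block_tour}) :
  transitive_set X -> transitive_set (slice i X).
Proof.
move=> /transitive_setP trX; apply/transitive_setP.
move=> _ _ _ /imsetP[y yX ->] /imsetP[x xX ->] /imsetP[z zX ->].
rewrite /= /blowup_edge /= ltnn; exact: trX.
Qed.

Lemma tr_blowup : (tr blowup <= m * tr block_tour)%N.
Proof.
have [X /transitive_setP trX <-] := tr_witness blowup.
rewrite -sum1_card (partition_big (fun u : blowup => u.1) predT) //=.
rewrite -[leqRHS]/(muln _ _) -[m in leqRHS]card_ord -sum_nat_const.
apply: leq_sum => i _; rewrite sum1dep_card.
pose Y : {set block_tour} := [set x | (i, x) \in X].
have trY : transitive_set Y.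
  apply/transitive_setP => y x z; rewrite !inE => yX xX zX exy eyz.
  have := trX _ _ _ yX xX zX; rewrite /= /blowup_edge /= ltnn; exact.
apply: leq_trans (leq_tr trY); rewrite -(card_slice i); apply/subset_leq_card.
apply/subsetP => -[j x]; rewrite !inE /= => /andP[xX /eqP ji].
by apply/imsetP; exists x; rewrite ?inE -?ji.
Qed.

Lemma almost_complete_slice L (i j : 'I_m) (X Y : {set V}) : (i < j)%N ->
  (L * pairs (fun x y => skew x y == kappa) X Y <= #|X| * #|Y|)%N ->
  almost_complete L (slice i X) (slice j Y).
Proof.
move=> ij; rewrite /almost_complete !card_slice; apply: leq_trans.
rewrite leq_mul2l; apply/orP; right.
rewrite /pairs big_imset /=; last by move=> x y _ _ [].
apply: leq_sum => x _; rewrite /deg -[leqRHS](card_slice j); apply/subset_leq_card.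
apply/subsetP => u; rewrite inE => /andP[/imsetP[y yY ->]].
rewrite /nonedge /= /blowup_edge /= ij negbK => xy.
by apply/imsetP; exists y; rewrite // inE yY.
Qed.

Lemma pairs_skewT X : (#|K| * pairs (fun x y => skew x y == kappa)%R setT X)%N =
  (#|[set: V]| * #|X|)%N.
Proof.
rewrite pairsC big_distrr mulnC -sum_nat_const; apply: eq_bigr => w _.
by rewrite cardsT -(card_skew_eq w kappa); congr (_ * #|pred_of_set _|)%N;
  apply/setP => u; rewrite !inE.
Qed.

Lemma pairs_skewTr X : (#|K| * pairs (fun x y => skew x y == kappa)%R X setT)%N =
  (#|X| * #|[set: V]|)%N.
Proof.
rewrite big_distrr -sum_nat_const; apply: eq_bigr => w _.
rewrite cardsT -(card_skew_eq w (- kappa)); congr (_ * #|pred_of_set _|)%N.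
by apply/setP => u; rewrite !inE skewN eqr_oppLR.
Qed.
End SkewForm.

(** Averaging over the values of the form. One transitive set X serves in all transitive slices, so
    a single [kappa] suffices. *)
Lemma exists_sparse_color (K : finFieldType) D (X : {set 'rV[K]_D * 'rV[K]_D * K}) :
  exists kappa : K, #|K| * pairs (fun x y => skew x y == kappa)%R X X <= #|X| * #|X|.
Proof.
apply: contrapT => none.
have gt kappa : #|X| * #|X| < #|K| * pairs (fun x y => skew x y == kappa)%R X X.
  by rewrite ltnNge; apply/negP => le; apply: none; exists kappa.
have total : \sum_kappa pairs (fun x y => skew x y == kappa)%R X X = #|X| * #|X|.
  rewrite exchange_big -sum_nat_const; apply: eq_bigr => x _.
  rewrite -[RHS]sum1_card (partition_big (skew x) predT) //=.
  by apply: eq_bigr => kappa _; rewrite sum1dep_card.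
have : \sum_(kappa : K) #|X| * #|X| < \sum_kappa #|K| * pairs (fun x y => skew x y == kappa)%R X X.
  rewrite [ltnLHS](bigD1 0%R) // [ltnRHS](bigD1 0%R) //= -addSn leq_add //.
  by apply: leq_sum => kappa _; apply: ltnW.
by rewrite sum_nat_const -big_distrr /= total ltnn.
Qed.

(** An m-sequence without strong pairs forces the other alternative of the property, which names a
    member of the family. The constants are fixed in the order L and c, then p, then D. *)
Lemma strong_EH_nonempty (R : realType) (I : finType) (H : I -> tournament)
    (F : forall i, H i -> nat) (m : nat) (v : m.-tuple bool)
    (eta : (zeta v m).-tuple nat) :
  (forall n, n \in (eta : seq nat) -> 0 < n) -> strong_EH R F eta -> inhabited I.
Proof.
move=> eta_gt0 strong.
pose q := parts_count eta.
pose Q := (\max_i q i).+1.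
have q_gt0 i : 0 < q i by apply: parts_count_gt0.
have qQ i : q i <= Q by apply: leq_trans (leq_bigmax i) _.
have q1 i : ~~ tnth v i -> q i = 1 by rewrite /q /parts_count => /negbTE->.
pose C := 2 * Q * m.+1.
have [L0 [c [c0 strongC]]] := strong_EH_inv strong (ltn0Sn _ : 0 < C).
pose L := L0.+2.
(* Cutting slices into parts may lose a factor 2Q on each side of a pair; the added 2 makes p
   odd. *)
have [p p_gt p_prime] := prime_above (L * (2 * Q) ^ 2 + 2).
pose K : finFieldType := 'F_p.
have cardK : #|K| = p by apply: card_Fp.
have K_odd : (1 != -1 :> K)%R.
  rewrite -subr_eq0 opprK -(natrD _ 1 1) -(dvdn_pcharf (pchar_Fp p_prime)).
  by rewrite gtnNdvd //; lia.
pose D := (maxn Q (Num.trunc ((m.+1 * p)%:R / (c ^+ 2))%R)).+1.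
pose U := block_tour D K_odd.
have cardU : 2 ^ D <= #|U|.
  rewrite card_prod card_prod card_mx mul1n cardK.
  apply: leq_trans (_ : p ^ D <= _); first by rewrite leq_exp2r //; lia.
  by rewrite -mulnA leq_pmulr // muln_gt0 expn_gt0; lia.
have D_tr : D < tr U by apply: tr_log.
have [S trS cardS] := tr_witness U.
have [kappa kappaP] := exists_sparse_color S.
(* With [m.+1] slices T is nonempty even for m = 0; the blocks lie in the first m of them. *)
pose T := blowup D K_odd m.+1 kappa.
have cardT : #|T| = m.+1 * #|U| by rewrite card_prod card_ord.
have T0 : 0 < #|T|.
  by rewrite cardT muln_gt0 /=; apply: leq_trans cardU; rewrite expn_gt0.
have D_trT : D < tr T.
  apply: leq_trans D_tr _; rewrite -cardS -(card_slice K_odd kappa (ord0 : 'I_m.+1) S).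
  exact/leq_tr/transitive_slice.
pose B (i : 'I_m) : {set T} :=
  slice K_odd kappa (widen_ord (leqnSn m) i) (if tnth v i then S else setT).
have [||i j ij|i vi|i vi|i vi|P [fam PB large]] :=
  @chop_family T m (tnth v) q m.+1 B.
- exact: q_gt0.
- exact: q1.
- apply/pred0Pn => -[x /andP[/imsetP[y _ ->] /imsetP[z _ [e]]]].
  by move=> _; case/eqP: ij; apply: val_inj.
- rewrite /B vi; split; first exact: transitive_slice.
  rewrite card_slice cardS; apply: leq_trans (qQ i) _.
  by apply: leq_trans (ltnW D_tr); rewrite /D; lia.
- by rewrite /B vi card_slice cardS; apply: tr_blowup.
- by rewrite /B (negbTE vi) card_slice cardsT cardT.
have {}fam : block_family (tnth v) q C P by apply: fam.
have blockB i : block q P i \subset B i by apply/bigcupsP => k _; apply: PB.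
have block_large i : #|B i| <= 2 * Q * #|block q P i|.
  apply: leq_trans (large i 0 (q_gt0 i)) _.
  apply: leq_mul; first by rewrite leq_mul2l qQ.
  by apply: subset_leq_card; apply: (bigcup_sup (Ordinal (q_gt0 i))).
have denseB (i j : 'I_m) : i < j -> almost_complete p (B i) (B j).
  move=> ij; apply: almost_complete_slice => //; rewrite -cardK.
  case: (tnth v i); case: (tnth v j); first exact: kappaP.
  - by rewrite pairs_skewTr.
  - by rewrite pairs_skewT.
  - by rewrite pairs_skewT.
have dense (i j : 'I_m) : i < j -> almost_complete L (block q P i) (block q P j).
  move=> ij; have := denseB i j ij; rewrite /almost_complete => dB.
  have Q0 : 0 < (2 * Q) ^ 2 by rewrite expn_gt0.
  rewrite -(leq_pmul2r Q0) mulnAC.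
  apply: leq_trans (_ : p * pairs (nonedge T) (B i) (B j) <= _).
    by rewrite leq_mul ?pairs_sub //; lia.
  apply: leq_trans dB _; apply: leq_trans (leq_mul (block_large i) (block_large j)) _.
  by rewrite -mulnn mulnACA mulnC.
have [||[i _]|[X [Y [_ _ cX cY dens]]]] :=
  strongC T (L%:R^-1)%R (family_mseq eta P) T0.
- by rewrite invr_ge0 ler0n /= lef_pV2 ?posrE ?ltr0n ?ler_nat.
- by apply: (is_mseq_family _ _ _ _ _ fam).
- by exists.
exfalso.
(* A strong pair gives |X||Y| >= c^2 |T| tr(T), so this bound would force tr(T) <= (m + 1)p/c^2,
   against the choice of D. *)
have XY : #|X| * #|Y| <= m.+1 * p * #|T|.
  rewrite -cardK; case: dens => /density1_complete; first exact: complete_blowup.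
  by rewrite mulnC; apply: complete_blowup.
have {}cY : (c * (tr T)%:R <= #|Y|%:R :> R)%R.
  case: cY => [cY|[]//]; apply: le_trans cY.
  by rewrite ler_pM2l // ler_nat leq_tr_card.
have c20 : (0 < c ^+ 2 :> R)%R by rewrite exprn_gt0.
have T0R : (0 < #|T|%:R :> R)%R by rewrite ltr0n.
have : (c ^+ 2 * (tr T)%:R <= (m.+1 * p)%:R :> R)%R.
  rewrite -(ler_pM2r T0R) -natrM; move: XY; rewrite -(ler_nat R) => /(le_trans _); apply.
  rewrite natrM (_ : (_ * _ * _ = c * #|T|%:R * (c * (tr T)%:R))%R); last by ring.
  by apply: ler_pM => //; apply: mulr_ge0; rewrite ?ler0n ?(ltW c0).
apply/negP; rewrite -ltNge -ltr_pdivrMl // mulrC.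
apply: lt_le_trans (truncnS_gt _) _; rewrite ler_nat.
by apply: leq_trans (ltnW D_trT); rewrite ltnS leq_maxr.
Qed.

Theorem theorem10 (R : realType) (m : nat) (v : m.-tuple bool)
    (eta : (zeta v m).-tuple nat) (eta_gt0 : forall n, n \in (eta : seq nat) -> (0 < n)%N)
    (r s : nat) (H1 : 'I_r -> tournament) (H2 : 'I_s -> tournament)
    (F : forall i, H1 i -> nat) (G : forall j, H2 j -> nat)
    (F_range : forall i x, (1 <= F i x <= long_size eta)%N)
    (G_range : forall j y, (1 <= G j y <= long_size eta)%N)
    (F_inj : forall i, injective (F i)) (G_inj : forall j, injective (G j))
    (FG_orth : forall i j, orthogonal_labels (F i) (G j))
    (H1_strong : strong_EH R F eta) (H2_strong : strong_EH R G eta) :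
  EH_property R (fun ij : 'I_r * 'I_s =>
    tprod (F_inj ij.1) (G_inj ij.2) (FG_orth ij.1 ij.2)).
Proof.
have [i0] := strong_EH_nonempty eta_gt0 H1_strong.
have [j0] := strong_EH_nonempty eta_gt0 H2_strong.
apply: (EH_tprod eta_gt0 _ _ F_inj G_inj FG_orth H1_strong H2_strong i0 j0).
  by move=> i x; case/andP: (F_range i x).
by move=> j y; case/andP: (G_range j y).
Qed.
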